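(* Suppose that $\mathcal{K}(y)\equiv\mathcal{K}$ does not depend on $y\in\mathbb{R}$. Let $x\ge0$, let $X^*=(X^*_t)_{t\ge 0}\in\mathcal{A}(x)$ be the extremal process, i.e. the solution of $dX^*_t=m(X^*_t)\,dt+s(X^*_t)\,dW_t$, $X_0^*=x$, where $m,s:\mathbb{R}\to\mathbb{R}$ are measurable, $s>0$, and $\frac{m(y)}{s^2(y)}=\sup\{\frac{\mu}{\sigma^2}:(\mu,\sigma)\in\mathcal{K}\}$ for all $y\in\mathbb{R}$; and let $X=(X_t)_{t\ge0}\in\mathcal{A}(x)$ be arbitrary, with drift $(\mu_t)$ and volatility $(\sigma_t)$. Put $M_t:=\sup_{0\le u\le t}X_u$ and $M^*_t:=\sup_{0\le u\le t}X^*_u$. Let $T,U:\mathbb{R}_+\to\mathbb{R}_+$ be the (random) time changes with $T\big(\int_0^t\sigma_u^2\,du\big)=t$ and $U\big(\int_0^t s^2(X^*_u)\,du\big)=t$ for all $t\ge0$. Then for every $\alpha\in[0,1]$, $$\big(X_{T(t)}-\alpha M_{T(t)}\big)_{t\ge0}\le_{st}\big(X^*_{U(t)}-\alpha M^*_{U(t)}\big)_{t\ge0}.$$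
   Context: Setting. A set $\mathcal{K}(y)\subset\mathbb{R}\times(0,\infty)$ of admissible (drift, volatility) pairs is given for each $y\in\mathbb{R}$ (here the same set $\mathcal{K}$ for all $y$). On a filtered probability space $(\Omega,\mathbb{F},(\mathbb{F}_t)_{t\ge0},\mathbb{P})$ with an $(\mathbb{F}_t)$-Brownian motion $W$, $\mathcal{A}(x)$ denotes the set of all processes $X$ of the form $dX_t=\mu_t\,dt+\sigma_t\,dW_t$, $X_0=x$, where $(\mu_t)$ and $(\sigma_t)$ are progressively measurable, $(\mu_t,\sigma_t)\in\mathcal{K}(X_t)$ for all $t$, and $\int_0^t(|\mu_u|+\sigma_u^2)\,du<\infty$ $\mathbb{P}$-a.s. for all $t\ge0$. Standing assumptions: measurable functions $m$ and $s>0$ with $\frac{m(y)}{s^2(y)}=\sup\{\frac{\mu}{\sigma^2}:(\mu,\sigma)\in\mathcal{K}(y)\}$ for all $y\in\mathbb{R}$ exist, and the SDE $dX^*_t=m(X^*_t)\,dt+s(X^*_t)\,dW_t$ has a unique weak solution. Stochastic order of processes: $(X_t)\le_{st}(Y_t)$ means $\mathbb{E}\,h(X_{t_1},\dots,X_{t_n})\le\mathbb{E}\,h(Y_{t_1},\dots,Y_{t_n})$ for all $n\in\mathbb{N}$, $0\le t_1\le\dots\le t_n$ and all measurable $h:\mathbb{R}^n\to\mathbb{R}$ that are increasing in all components and for which the expectations exist. *)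

(* Defs.v *)
From HB Require Import structures.
From mathcomp Require Import all_boot all_order all_algebra.
From mathcomp Require Import all_classical all_reals all_analysis.

Set Implicit Arguments.
Unset Strict Implicit.
Unset Printing Implicit Defensive.
Import Order.TTheory GRing.Theory Num.Theory.
Import numFieldNormedType.Exports.
Local Open Scope classical_set_scope.
Local Open Scope ring_scope.

(** Processes are functions [R -> Omega -> R]; the time set is [0, +oo[, and
    their values at negative times are never used.  *)

Section FilteredSpace.
Context {R : realType} {d : measure_display} {Omega : measurableType d}.
Implicit Types (G : set (set Omega)) (F : R -> set (set Omega)).
Implicit Types (Z X W : R -> Omega -> R).

(** No completeness or right-continuity is required. *)
Definition is_filtration F : Prop :=
  [/\ forall t : R, 0 <= t -> sigma_algebra setT (F t),
      forall t : R, 0 <= t -> F t `<=` measurable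
    & forall s t : R, 0 <= s -> s <= t -> F s `<=` F t].

Definition measurable_wrt G (f : Omega -> R) : Prop :=
  @measurable_fun _ _ (g_sigma_algebraType G) (measurableTypeR R) setT f.

Definition adapted F Z : Prop := forall t : R, 0 <= t -> measurable_wrt (F t) (Z t).

Definition progressive F Z : Prop := forall t : R, 0 <= t ->
  @measurable_fun _ _ (measurableTypeR R * g_sigma_algebraType (F t))%type
    (measurableTypeR R) (`[0, t] `*` setT) (fun p => Z p.1 p.2).

Definition continuous_paths Z : Prop :=
  forall w, {within `[0, +oo[, continuous (fun t => Z t w)}.

(** The second parameter of [normal_prob] is the standard deviation. *)
Definition brownian_motion F (P : probability Omega R) W : Prop :=
  [/\ adapted F W,
      continuous_paths W,
      {ae P, forall w, W 0 w = 0},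
      forall (s t : R) (B : set (measurableTypeR R)), 0 <= s -> s < t ->
        measurable B ->
        P [set w | B (W t w - W s w)] = normal_prob 0 (Num.sqrt (t - s)) B
    & forall (s t : R) (A : set Omega) (B : set (measurableTypeR R)), 0 <= s -> s < t ->
        F s A -> measurable B ->
        (P (A `&` [set w | B (W t w - W s w)%R])
         = P A * P [set w | B (W t w - W s w)%R])%E].

(** The process [\sum_(i < n) xi_i 1_(]t_i, t_(i+1)])]. *)
Record simple_process := SimpleProcess {
  sp_size : nat;
  sp_time : nat -> R;
  sp_coef : nat -> Omega -> R }.

Definition simple_adapted F (H : simple_process) : Prop :=
  [/\ 0 <= sp_time H 0,
      forall i, sp_time H i <= sp_time H i.+1,
      forall i, measurable_wrt (F (sp_time H i)) (sp_coef H i)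
    & forall i, exists C : R, forall w, `|sp_coef H i w| <= C].

Definition simple_val (H : simple_process) (t : R) (w : Omega) : R :=
  \sum_(i < sp_size H)
    sp_coef H i w * \1_(`]sp_time H i, sp_time H i.+1]) t.

Definition simple_integral W (H : simple_process) (t : R) (w : Omega) : R :=
  \sum_(i < sp_size H)
    sp_coef H i w * (W (Num.min (sp_time H i.+1) t) w
                     - W (Num.min (sp_time H i) t) w).

Definition cvg_in_prob0 (P : probability Omega R) (Z : nat -> Omega -> \bar R)
    : Prop :=
  forall e : R, 0 < e -> (fun n => P [set w | (e%:E <= Z n w)%E]) @ \oo --> 0%E.

(** [I] is (a continuous version of) the Ito integral [\int_0^. sigma dW]:
    the limit, uniformly on compacts in probability, of the elementary
    integrals of simple processes [H n] that approximate [sigma] in the sense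
    that [\int_0^t (H n - sigma)^2 du] tends to 0 in probability.  *)
Definition is_ito_integral F (P : probability Omega R) W
    (sigma I : R -> Omega -> R) : Prop :=
  [/\ forall t : R, 0 <= t ->
        @measurable_fun _ _ Omega (measurableTypeR R) setT (I t),
      continuous_paths I
    & exists H : nat -> simple_process,
        (forall n, simple_adapted F (H n)) /\
        forall t : R, 0 <= t ->
          cvg_in_prob0 P (fun n w => \int[lebesgue_measure]_(u in `[0%R, t])
             ((simple_val (H n) u w - sigma u w) ^+ 2)%:E)%E /\
          cvg_in_prob0 P (fun n w => ereal_sup
             [set (`|simple_integral W (H n) u w - I u w|)%:E
             | u in `[0, t]])].

(** [dX_t = mu_t dt + sigma_t dW_t], [X_0 = x]. *)
Definition ito_process F (P : probability Omega R) W (x : R)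
    (X mu sigma : R -> Omega -> R) : Prop :=
  [/\ adapted F X /\ continuous_paths X,
      progressive F mu,
      progressive F sigma,
      {ae P, forall w, forall t : R, 0 <= t ->
        (\int[lebesgue_measure]_(u in `[0%R, t])
           (`|mu u w| + sigma u w ^+ 2)%:E < +oo)%E}
    & exists2 I : R -> Omega -> R, is_ito_integral F P W sigma I &
        {ae P, forall w, forall t : R, 0 <= t ->
          X t w = x + \int[lebesgue_measure]_(u in `[0, t]) mu u w + I t w}].

(** [X] belongs to [A(x)], with drift [mu] and volatility [sigma]. *)
Definition admissible_with F (P : probability Omega R) W
    (K : R -> set (R * R)) (x : R) (X mu sigma : R -> Omega -> R) : Prop :=
  ito_process F P W x X mu sigma /\
  {ae P, forall w, forall t : R, 0 <= t -> K (X t w) (mu t w, sigma t w)}.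

Definition admissible F (P : probability Omega R) W
    (K : R -> set (R * R)) (x : R) : set (R -> Omega -> R) :=
  [set X | exists mu sigma, admissible_with F P W K x X mu sigma].

Definition sde_solution F (P : probability Omega R) W (m s : R -> R) (x : R)
    X : Prop :=
  ito_process F P W x X (fun t w => m (X t w)) (fun t w => s (X t w)).

Definition running_max X (t : R) (w : Omega) : R :=
  sup [set X u w | u in `[0, t]].

(** [\int_0^t sigma_u^2 du]. *)
Definition clock (sigma : R -> Omega -> R) (t : R) (w : Omega) : R :=
  \int[lebesgue_measure]_(u in `[0, t]) (sigma u w ^+ 2).

(** A finite-valued, nondecreasing random time change with [T (A t) = t].
    Because [T] is monotone and finite on the whole half-line, [A] must be
    unbounded; beyond [sup A] the equation alone would leave [T] arbitrary.  *)
Definition inverse_time_change (P : probability Omega R)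
    (A T : R -> Omega -> R) : Prop :=
  [/\ forall t : R, 0 <= t ->
        @measurable_fun _ _ Omega (measurableTypeR R) setT (T t),
      forall (t : R) (w : Omega), 0 <= t -> 0 <= T t w,
      {ae P, forall w, forall r t : R, 0 <= r -> r <= t -> T r w <= T t w}
    & {ae P, forall w, forall t : R, 0 <= t -> T (A t w) w = t}].

(** [X_(T(t)) - alpha M_(T(t))], with [M] the running maximum of [X]. *)
Definition time_changed_drawdown (alpha : R) X (T : R -> Omega -> R)
    (t : R) (w : Omega) : R :=
  X (T t w) w - alpha * running_max X (T t w) w.

Definition marginal X n (t : n.-tuple R) (w : Omega)
    : n.-tuple (measurableTypeR R) :=
  [tuple X (tnth t i) w | i < n].

(** The expectation is defined in [-oo, +oo]. *)
Definition expectation_exists (P : probability Omega R) (Y : Omega -> R)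
    : Prop :=
  (\int[P]_w ((EFin \o Y)^\+ w) < +oo)%E \/
  (\int[P]_w ((EFin \o Y)^\- w) < +oo)%E.

End FilteredSpace.

Definition same_law {R : realType}
    {d1 : measure_display} {Omega1 : measurableType d1}
    (P1 : probability Omega1 R) (X1 : R -> Omega1 -> R)
    {d2 : measure_display} {Omega2 : measurableType d2}
    (P2 : probability Omega2 R) (X2 : R -> Omega2 -> R) : Prop :=
  forall n (t : n.-tuple R) (B : set (n.-tuple (measurableTypeR R))),
    (forall i, 0 <= tnth t i) -> measurable B ->
    P1 (marginal X1 t @^-1` B) = P2 (marginal X2 t @^-1` B).

Definition weak_solution {R : realType} (m s : R -> R) (x : R)
    {d : measure_display} {Omega : measurableType d}
    (P : probability Omega R) (X : R -> Omega -> R) : Prop :=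
  exists (F : R -> set (set Omega)) (W : R -> Omega -> R),
    [/\ is_filtration F, brownian_motion F P W & sde_solution F P W m s x X].

(** Existence of a weak solution and uniqueness in law. *)
Definition unique_weak_solution {R : realType} (m s : R -> R) (x : R) : Prop :=
  (exists (d : measure_display) (Omega : measurableType d)
     (P : probability Omega R) (X : R -> Omega -> R),
     weak_solution m s x P X) /\
  (forall (d1 : measure_display) (Omega1 : measurableType d1)
     (P1 : probability Omega1 R) (X1 : R -> Omega1 -> R)
     (d2 : measure_display) (Omega2 : measurableType d2)
     (P2 : probability Omega2 R) (X2 : R -> Omega2 -> R),
     weak_solution m s x P1 X1 -> weak_solution m s x P2 X2 ->
     same_law P1 X1 P2 X2).

Definition st_le {R : realType}
    {d1 : measure_display} {Omega1 : measurableType d1}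
    (P1 : probability Omega1 R) (X : R -> Omega1 -> R)
    {d2 : measure_display} {Omega2 : measurableType d2}
    (P2 : probability Omega2 R) (Y : R -> Omega2 -> R) : Prop :=
  forall n (t : n.-tuple R) (h : n.-tuple (measurableTypeR R) -> R),
    sorted <=%R (0 :: t) ->
    @measurable_fun _ _ (n.-tuple (measurableTypeR R)) (measurableTypeR R)
      setT h ->
    (forall a b, (forall i, tnth a i <= tnth b i) -> h a <= h b) ->
    expectation_exists P1 (h \o marginal X t) ->
    expectation_exists P2 (h \o marginal Y t) ->
    ('E_P1[h \o marginal X t] <= 'E_P2[h \o marginal Y t])%E.

(* Main.v *)
(* Since K does not depend on the position, m / s^2 is a constant c, and c bounds
   mu / sigma^2 from above. Run by its own clock, the stochastic integral of X becomes a
   Brownian motion B (Dambis-Dubins-Schwarz), so with Z_t = x + c t + B_t the time-changed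
   process is Z_t - D_t for a nondecreasing D >= 0. The running maximum of Z - D is at least
   that of Z minus D_t, hence for alpha <= 1 the drawdown of Z - D is at most that of Z. For X^*
   the same construction gives D = 0, and the law of the drawdown of Z depends only on c, x
   and alpha.

   The increments of B are identified without stopping times. The integral is the limit of
   integrals of simple processes on fine grids. Grouping the grid steps into phases
   according to the discrete clock, and testing with a product of functions of the phase
   increments, each step can be integrated out by Brownian scaling, and one is left with
   the heat semigroup at the total variance of each phase. *)
Require Import Defs.
From HB Require Import structures.
From mathcomp Require Import all_boot all_order all_algebra.
From mathcomp Require Import all_classical all_reals all_analysis.
From mathcomp Require Import measurable_realfun ring lra.

Import Order.TTheory GRing.Theory Num.Theory.
Import numFieldNormedType.Exports.
Local Open Scope classical_set_scope.
Local Open Scope ring_scope.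

Import HBNNSimple.

(** * Measure-theoretic preliminaries *)

(** The obstacle is that [T t] is a random time and that the stochastic integral is known only as a
    limit in probability, over a filtration that need be neither complete nor right-continuous. The
    law is therefore computed before any limit is taken. The variance of a grid step is known before
    the step is made, so the phase containing the step is predictable and the increment of [W] over
    it is still independent of everything chosen so far.

    A phase does not have total variance exactly [delta]: it can exceed [delta] by the variance of
    one step, at most [eta]. This makes the expectation exactly independent of the coefficients for
    each [eta], and the filling disappears in the limit.

    The limit is pathwise: Borel-Cantelli gives almost sure convergence, uniform on compacts, and
    [T] is continuous as the inverse of a continuous, strictly increasing, unbounded clock.
    Drawdowns are then read off a grid of mesh [1/(k+1)], whose increments are phases of that
    length. *)

Lemma ge0_le_integral_ae d (T : measurableType d) (R : realType)
    (mu : {measure set T -> \bar R}) (f g : T -> \bar R) :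
  (forall x, 0 <= f x)%E -> (forall x, 0 <= g x)%E ->
  {ae mu, forall x, f x <= g x}%E ->
  (\int[mu]_x f x <= \int[mu]_x g x)%E.
Proof.
move=> f0 g0 [N [mN N0 fgN]].
(* Neither [f] nor [g] is assumed measurable. The integral is a supremum over simple functions below
   the integrand, and such a function below [f] lies below [g] once it is cut to 0 on the null set
   [N]. *)
rewrite (ge0_integralTE _ f0); apply: ge_ereal_sup => _ /= [h hf <-].
have mC : measurable (~` N) by exact: measurableC.
rewrite -(integralT_nnsfun mu h).
rewrite (ge0_negligible_integral mN _ _ _ N0)//; last 2 first.
- exact/measurable_EFinP.
- by move=> x _; rewrite lee_fin.
rewrite setTD (integral_nnsfun _ mC) (ge0_integralTE _ g0).
apply: ereal_sup_ubound => /=; exists (proj_nnsfun h mC) => /=.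
  move=> x; rewrite /mindic; have [Nx|Nx] := pselect (N x).
    by rewrite indicE memNset ?mulr0//=; apply.
  rewrite indicE mem_set//= mulr1 (le_trans (hf x))//.
  by apply: contrapT => fg; apply/Nx/fgN.
by rewrite mrestrict.
Qed.

Lemma measurable_set_le d (T : measurableType d) (R : realType) (f g : T -> R) :
  measurable_fun setT f -> measurable_fun setT g -> measurable [set x | f x <= g x].
Proof. by move=> mf mg; rewrite -[X in measurable X]setTI; exact: measurable_fun_le. Qed.

Lemma measurable_set_lt d (T : measurableType d) (R : realType) (f g : T -> R) :
  measurable_fun setT f -> measurable_fun setT g -> measurable [set x | f x < g x].
Proof.
move=> mf mg; rewrite (_ : [set x | _] = ~` [set x | g x <= f x]).
  by apply: measurableC; exact: measurable_set_le.
by apply/seteqP; split => x /=; rewrite ltNge => /negP.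
Qed.

Lemma truncn_grid_cvg (R : realType) (t : R) : 0 <= t ->
  (Num.trunc (t * n.+1%:R))%:R / n.+1%:R @[n --> \oo] --> t.
Proof.
move=> t0; apply/cvgrPdist_le => e e0.
near=> n.
have n0 : (0 : R) < n.+1%:R by rewrite ltr0n.
have /andP[h1 h2] : (Num.trunc (t * n.+1%:R))%:R <= t * n.+1%:R <
    (Num.trunc (t * n.+1%:R)).+1%:R.
  by apply: truncn_itv; rewrite mulr_ge0.
rewrite ger0_norm ?subr_ge0 ?ler_pdivrMr//.
rewrite lerBlDr -lerBlDl ler_pdivlMr// mulrBl.
have : e^-1 <= n.+1%:R.
  by apply: le_trans (_ : n%:R <= _); [near: n; exact: nbhs_infty_ger|rewrite ler_nat].
rewrite -[e^-1]mulr1 ler_pdivrMl// => h3.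
rewrite -(addn1 (Num.trunc _)) natrD in h2; lra.
Unshelve. all: by end_near. Qed.

(** The time [tau] is approximated from below by grid points. Only countably many of them occur, so
    the discretised composite is measurable piece by piece, and continuity along each path gives the
    limit. *)
Lemma measurable_fun_time_subst d (S : measurableType d) (R : realType)
    (f : R -> S -> R) (tau : S -> R) :
  (forall t, 0 <= t -> measurable_fun setT (f t)) ->
  measurable_fun setT tau -> (forall x, 0 <= tau x) ->
  (forall x (a : nat -> R), (forall n, 0 <= a n) -> a @ \oo --> tau x ->
    f (a n) x @[n --> \oo] --> f (tau x) x) ->
  measurable_fun setT (fun x => f (tau x) x).
Proof.
move=> mf mtau tau0 cf.
pose a n x : R := (Num.trunc (tau x * n.+1%:R))%:R / n.+1%:R.
apply: (@measurable_fun_cvg _ _ _ _ (fun n x => f (a n x) x)); last first.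
  move=> x _; apply: (cf x (a ^~ x)); last exact: truncn_grid_cvg.
  by move=> n; rewrite divr_ge0.
move=> n _ B mB; rewrite setTI.
rewrite (_ : _ @^-1` B = \bigcup_r
   ([set x | r%:R <= tau x * n.+1%:R] `&` [set x | tau x * n.+1%:R < r.+1%:R] `&`
     f (r%:R / n.+1%:R) @^-1` B)).
  apply: bigcupT_measurable => r; apply: measurableI; last first.
    by rewrite -[X in measurable X]setTI; apply: mf => //; rewrite divr_ge0.
  have mt : measurable_fun setT (fun x => tau x * n.+1%:R) by exact: measurable_funM.
  by apply: measurableI; [exact: measurable_set_le|exact: measurable_set_lt].
apply/seteqP; split=> x /=.
  move=> Bx; exists (Num.trunc (tau x * n.+1%:R)) => //; split => //=.
  by apply/andP/truncn_itv; rewrite mulr_ge0.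
move=> [r _ [/= [h1 h2] h3]]; rewrite /a.
by rewrite (@truncn_def _ _ r)// h1.
Qed.

Lemma bounded_expectation_cvg d (T : measurableType d) (R : realType)
    (P : probability T R) (f_ : nat -> T -> R) (f : T -> R) :
  (forall n, measurable_fun setT (f_ n)) -> measurable_fun setT f ->
  (forall n x, 0 <= f_ n x <= 1) ->
  {ae P, forall x, f_ n x @[n --> \oo] --> f x} ->
  (\int[P]_x (f_ n x)%:E @[n --> \oo] --> \int[P]_x (f x)%:E)%E.
Proof.
move=> mf_ mf f01 cf.
have [] // := @dominated_convergence _ _ _ P setT measurableT (fun n x => (f_ n x)%:E)
  (EFin \o f) (cst 1%E).
- by move=> n; exact/measurable_EFinP.
- exact/measurable_EFinP.
- case: cf => N [mN N0 sN]; exists N; split => // x /= h; apply: sN => /= h'.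
  by apply: h => _; apply: cvg_EFin => //; apply: nearW.
- exact: finite_measure_integrable_cst.
- apply: aeW => x n _ /=; rewrite lee_fin.
  by have /andP[h1 h2] := f01 n x; rewrite ger0_norm.
Qed.

(** * Laws on tuples, tested by products of continuous functions *)

Definition rays (R : realType) : set (set R) :=
  [set B | B = setT \/ exists x, B = `]-oo, x[%classic].

Definition ray_boxes (R : realType) n : set (set (n.-tuple (measurableTypeR R))) :=
  [set A | exists2 B : 'I_n -> set R, (forall i, rays R (B i)) &
     A = [set y | forall i, B i (tnth y i)]].

Lemma raysI (R : realType) : setI_closed (rays R).
Proof.
move=> A B [->|[x ->]] [->|[y ->]]; rewrite ?setTI ?setIT; try by left.
- by right; exists y.
- by right; exists x.
- right; exists (Num.min x y); apply/seteqP; split => z /=; rewrite !in_itv/= lt_min.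
    by case=> -> ->.
  by move=> /andP[].
Qed.

Lemma rays_measurable (R : realType) (B : set R) : rays R B ->
  measurable (B : set (measurableTypeR R)).
Proof. by move=> [->|[x ->]]. Qed.

Lemma ray_boxes_measurable (R : realType) n (A : set (n.-tuple (measurableTypeR R))) :
  ray_boxes R n A -> measurable A.
Proof.
move=> [B rB ->].
rewrite (_ : [set y | _] = \bigcap_(i in [set: 'I_n]) ((@tnth n _)^~ i @^-1` B i)).
  apply: fin_bigcap_measurable => // i _; rewrite -[X in measurable X]setTI.
  by apply: measurable_tnth => //; exact: rays_measurable.
by apply/seteqP; split => y /= h i; [move=> _|]; exact: h.
Qed.

Lemma ray_boxes_generate (R : realType) n :
  @measurable _ (n.-tuple (measurableTypeR R)) = <<s @ray_boxes R n >>.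
Proof.
apply/seteqP; split; last first.
  apply: smallest_sub; first exact: sigma_algebra_measurable.
  by move=> A; exact: ray_boxes_measurable.
have mid : @measurable_fun _ _ (g_sigma_algebraType (@ray_boxes R n))
    (n.-tuple (measurableTypeR R)) setT (fun y => y).
  apply/measurable_fun_tnthP => i.
  apply: (measurability _ (RGenInftyO.measurableE R)) => // _ [_ [x ->] <-].
  apply: sub_sigma_algebra; rewrite setTI.
  exists (fun j => if j == i then `]-oo, x[%classic else setT).
    by move=> j; case: ifP => _; [right; exists x|left].
  apply/seteqP; split => y /=.
    by move=> h j; case: eqP => // ->.
  by move=> /(_ i); rewrite eqxx.
by move=> A mA; have := mid measurableT A mA; rewrite setTI.
Qed.

(** Continuous approximation of the indicator of an open ray. It vanishes at the endpoint [x] for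
    all [k], so the pointwise limit is the indicator of the open ray and not of the closed one. *)
Definition ray_ramp {R : realType} (x : R) (k : nat) (y : R) : R :=
  Num.min 1 (Num.max 0 (k%:R * (x - y))).

Lemma ray_ramp01 {R : realType} (x : R) k y : 0 <= ray_ramp x k y <= 1.
Proof. by rewrite /ray_ramp le_min ge_min lexx ler01 le_max lexx. Qed.

Lemma ray_ramp_continuous {R : realType} (x : R) k : continuous (ray_ramp x k).
Proof.
have cl : continuous (fun y : R => k%:R * (x - y)).
  by move=> y; apply: cvgM; [exact: cvg_cst|apply: cvgB; [exact: cvg_cst|exact: cvg_id]].
move=> y; rewrite /ray_ramp.
apply: (@continuous_min _ _ (cst 1) (fun y => Num.max 0 (k%:R * (x - y)))).
  exact: cst_continuous.
apply: (@continuous_max _ _ (cst 0)); first exact: cst_continuous.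
exact: cl.
Qed.

Lemma ray_ramp_cvg {R : realType} (x : R) y :
  ray_ramp x k y @[k --> \oo] --> (\1_(`]-oo, x[) y : R).
Proof.
rewrite indicE /=; have [yx|xy] := ltP y x.
  rewrite mem_set ?in_itv//=; apply: cvg_near_cst.
  near=> k; rewrite /ray_ramp; apply/eqP; rewrite eq_le ge_min lexx/=.
  rewrite le_min lexx/= le_max -ler_pdivrMr ?subr_gt0// mul1r.
  by apply/orP; right; near: k; exact: nbhs_infty_ger.
rewrite memNset; last by rewrite /= in_itv/= ltNge xy.
apply: cvg_near_cst; apply: nearW => k.
rewrite /ray_ramp max_l ?min_r// ?ler01//.
by rewrite mulr_ge0_le0// subr_le0.
Unshelve. all: by end_near. Qed.

Lemma cvg_prodr (R : realType) (I : Type) (r : seq I) (f : I -> nat -> R) (l : I -> R) :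
  (forall i, f i k @[k --> \oo] --> l i) ->
  \prod_(i <- r) f i k @[k --> \oo] --> \prod_(i <- r) l i.
Proof.
move=> fl; elim: r => [|i r IH].
  by rewrite big_nil; under eq_fun do rewrite big_nil; exact: cvg_cst.
rewrite big_cons; under eq_fun do rewrite big_cons.
by apply: cvgM.
Qed.

Lemma preimage_law_unique (R : realType) d (T : measurableType d)
    d1 (T1 : measurableType d1) (P1 : probability T1 R)
    d2 (T2 : measurableType d2) (P2 : probability T2 R)
    (Y1 : T1 -> T) (Y2 : T2 -> T) (G : set (set T)) :
  measurable = <<s G >> -> setI_closed G -> G setT ->
  measurable_fun setT Y1 -> measurable_fun setT Y2 ->
  (forall A, G A -> P1 (Y1 @^-1` A) = P2 (Y2 @^-1` A)) ->
  forall A, measurable A -> P1 (Y1 @^-1` A) = P2 (Y2 @^-1` A).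
Proof.
move=> mG GI GT mY1 mY2 H.
pose Z1 : {mfun T1 >-> T} := HB.pack Y1 (isMeasurableFun.Build _ _ _ _ _ mY1).
pose Z2 : {mfun T2 >-> T} := HB.pack Y2 (isMeasurableFun.Build _ _ _ _ _ mY2).
apply: (@measure_unique _ R _ G (fun=> setT) _ _ _ _ (pushforward P1 Z1) (pushforward P2 Z2)) => //.
- by rewrite bigcup_const.
- move=> _; have e : pushforward P1 Z1 setT = 1%E := probability_setT P1.
  by apply: (le_lt_trans _ (ltry 1)); rewrite -e.
Qed.

(** Boxes of open rays generate the product sigma-algebra and are stable under intersection, and
    their indicators are bounded pointwise limits of products of ramps. *)
Lemma tuple_law_unique (R : realType) d1 (T1 : measurableType d1) (P1 : probability T1 R)
    d2 (T2 : measurableType d2) (P2 : probability T2 R) n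
    (Y1 : T1 -> n.-tuple (measurableTypeR R)) (Y2 : T2 -> n.-tuple (measurableTypeR R)) :
  measurable_fun setT Y1 -> measurable_fun setT Y2 ->
  (forall g : 'I_n -> R -> R, (forall i, continuous (g i)) ->
     (forall i y, 0 <= g i y <= 1) ->
     (\int[P1]_w (\prod_i g i (tnth (Y1 w) i))%:E =
      \int[P2]_w (\prod_i g i (tnth (Y2 w) i))%:E)%E) ->
  forall S, measurable S -> P1 (Y1 @^-1` S) = P2 (Y2 @^-1` S).
Proof.
move=> mY1 mY2 H.
apply: (preimage_law_unique _ _ _ _ _ _ _ _ _ _ _ _ (ray_boxes_generate R n)) => //.
- move=> _ _ [B rB ->] [C rC ->]; exists (fun i => B i `&` C i).
    by move=> i; exact: raysI.
  apply/seteqP; split=> y /=; first by move=> [h1 h2] i; split; [exact: h1|exact: h2].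
  by move=> h; split => i; have [] := h i.
- by exists (fun=> setT); [left|apply/seteqP; split].
move=> A [B rB AE].
have [g [cg g01 gB]] : exists g : 'I_n -> nat -> R -> R, [/\ forall i k, continuous (g i k),
    forall i k y, 0 <= g i k y <= 1 & forall i y, g i k y @[k --> \oo] --> (\1_(B i) y : R)].
  have /choice[g gP] : forall i, exists g : nat -> R -> R, [/\ forall k, continuous (g k),
    forall k y, 0 <= g k y <= 1 & forall y, g k y @[k --> \oo] --> (\1_(B i) y : R)].
    move=> i; have [->|[x ->]] := rB i.
      exists (fun _ _ => 1); split.
      - by move=> k; exact: cst_continuous.
      - by move=> k y; rewrite ler01 lexx.
      - by move=> y; rewrite indicE in_setT; exact: cvg_cst.
    exists (ray_ramp x); split; [exact: ray_ramp_continuous|exact: ray_ramp01|exact: ray_ramp_cvg].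
  by exists g; split => i; have [] := gP i.
have key d (T : measurableType d) (P : probability T R) (Y : T -> n.-tuple (measurableTypeR R)) :
    measurable_fun setT Y ->
    (\int[P]_w (\prod_i g i k (tnth (Y w) i))%:E @[k --> \oo] --> P (Y @^-1` A))%E.
  move=> mY.
  have mA : measurable (Y @^-1` A).
    rewrite -[X in measurable X]setTI; apply: mY => //.
    by apply: ray_boxes_measurable; exists B.
  have -> : P (Y @^-1` A) = (\int[P]_w (\1_(Y @^-1` A) w)%:E)%E.
    by rewrite integral_indic// setIT.
  apply: bounded_expectation_cvg.
  - move=> k; apply: measurable_prod => i _.
    apply: (measurableT_comp (g := fun w => tnth (Y w) i)).
      exact: continuous_measurable_fun.
    by move/measurable_fun_tnthP: mY; exact.
  - exact: measurable_indic.
  - move=> k w; apply/andP; split.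
      by apply: prodr_ge0 => i _; have /andP[] := g01 i k (tnth (Y w) i).
    by apply: prodr_ile1 => i _; exact: g01.
  - apply: aeW => w.
    rewrite (_ : \1_(_) w = \prod_i (\1_(B i) (tnth (Y w) i))); last first.
      rewrite AE indicE; case: (boolP (w \in _)).
        by rewrite inE /= => h; rewrite big1// => i _; rewrite indicE mem_set.
      rewrite notin_setE /= => /existsNP[i Bi].
      by rewrite (bigD1 i)//= indicE memNset// mul0r.
    by apply: cvg_prodr => i; exact: gB.
have h1 := key _ _ P1 _ mY1; have h2 := key _ _ P2 _ mY2.
have: (\int[P1]_w (\prod_i g i k (tnth (Y1 w) i))%:E @[k --> \oo] --> P2 (Y2 @^-1` A))%E.
  apply: cvg_trans h2; apply: near_eq_cvg; apply: nearW => k.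
  by symmetry; apply: (H (fun i => g i k)) => i; [exact: cg|exact: g01].
by move: h1 => /cvg_lim <- // /cvg_lim <-.
Qed.

(** * Freezing, and scaling of normal laws *)

Lemma measurable_id_g_sigma d (T : measurableType d) (G : set (set T)) :
  G `<=` measurable ->
  @measurable_fun _ _ T (g_sigma_algebraType G) setT (fun x => x).
Proof.
move=> Gm _ A GA; rewrite setTI.
apply: (smallest_sub _ _ GA) => //; exact: sigma_algebra_measurable.
Qed.

(** Independence says that the pair formed by the identity, seen through [G], and [zeta] has a
    product law. Tonelli then integrates [zeta] out while the [G]-measurable argument is held
    fixed. *)
Lemma freezing (R : realType) d (T : measurableType d) (P : probability T R)
    (G : set (set T)) (zeta : T -> R) (phi : g_sigma_algebraType G * measurableTypeR R -> \bar R) :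
  sigma_algebra setT G -> G `<=` measurable -> measurable_fun setT (zeta : T -> measurableTypeR R) ->
  (forall (A : set T) (B : set (measurableTypeR R)), G A -> measurable B ->
     (P (A `&` zeta @^-1` B) = P A * P (zeta @^-1` B))%E) ->
  measurable_fun setT phi -> (forall x, 0 <= phi x)%E ->
  (\int[P]_w phi (w, zeta w) = \int[P]_w \int[P]_v phi (w, zeta v))%E.
Proof.
move=> sG Gm mz indep mphi phi0.
have mid := measurable_id_g_sigma _ _ _ Gm.
pose i : {mfun T >-> g_sigma_algebraType G} :=
  HB.pack (fun x : T => x : g_sigma_algebraType G) (isMeasurableFun.Build _ _ _ _ _ mid).
pose z : {mfun T >-> measurableTypeR R} := HB.pack zeta (isMeasurableFun.Build _ _ _ _ _ mz).
have miz : measurable_fun setT (fun w => (i w, z w)).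
  exact: measurable_fun_pair.
pose iz : {mfun T >-> (g_sigma_algebraType G * measurableTypeR R)%type} :=
  HB.pack (fun w => (i w, z w)) (isMeasurableFun.Build _ _ _ _ _ miz).
have joint X : measurable X -> (distribution P i \x distribution P z)%E X = distribution P iz X.
  apply: product_measure_unique => A B mA mB.
  rewrite [LHS](_ : _ = P (A `&` zeta @^-1` B)); last by congr (P _); apply/seteqP; split.
  rewrite indep//.
  by move: mA; rewrite /measurable/= sigma_algebra_id.
transitivity (\int[distribution P iz]_x phi x)%E.
  by rewrite ge0_integral_distribution.
transitivity (\int[distribution P i \x distribution P z]_x phi x)%E.
  by apply: eq_measure_integral => A mA _; exact/esym/joint.
rewrite fubini_tonelli1//= ge0_integral_distribution//; last 2 first.
- exact: measurable_fun_fubini_tonelli_F.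
- by move=> x; apply: integral_ge0.
apply: eq_integral => w _ /=; rewrite /fubini_F ge0_integral_distribution//.
exact: measurableT_comp.
Qed.

Lemma integral_normal_prob (R : realType) (m s : R) (f : R -> R) :
  measurable_fun setT f -> (forall y, 0 <= f y <= 1) ->
  (\int[normal_prob m s]_y (f y)%:E =
   \int[lebesgue_measure]_y (f y * normal_pdf m s y)%:E)%E.
Proof.
move=> mf f01.
have intf : (normal_prob m s).-integrable setT (EFin \o f).
  apply: (@le_integrable _ _ _ _ _ measurableT _ (cst 1%E)).
  - exact/measurable_EFinP.
  - move=> y _ /=; rewrite lee_fin normr1; have /andP[h1 h2] := f01 y.
    by rewrite ger0_norm.
  - exact: finite_measure_integrable_cst.
rewrite -(Radon_Nikodym_change_of_variables (normal_prob_dominates m s))//=.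
apply: ae_eq_integral => //.
- apply: emeasurable_funM => //; first exact/measurable_EFinP.
  apply: (measurable_int lebesgue_measure).
  apply: Radon_Nikodym_integrable; exact: normal_prob_dominates.
- by apply/measurable_EFinP; apply: measurable_funM => //; exact: measurable_normal_pdf.
under [X in ae_eq _ _ _ X]eq_fun do rewrite EFinM.
apply: ae_eqe_mul2l => /=.
rewrite Radon_NikodymE//=; first exact: normal_prob_dominates.
move=> abmu.
case: cid => /= h [h1 h2 h3].
apply: integral_ae_eq => //=.
+ by apply/measurable_EFinP; exact: measurable_normal_pdf.
+ by move=> E E01 mE; rewrite -h3.
Qed.

Lemma normal_pdf_scale (R : realType) (s c y : R) : 0 < s -> 0 < c ->
  normal_pdf 0 (c * s) (c * y) * c = normal_pdf 0 s y.
Proof.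
move=> s0 c0.
rewrite !normal_pdfE ?gt_eqF ?mulr_gt0// /normal_peak /normal_fun !subr0.
rewrite mulrAC; congr (_ * _).
  rewrite exprMn -mulrnAr -mulrA (sqrtrM _ (sqr_ge0 c)) sqrtr_sqr gtr0_norm//.
  rewrite invfM mulrAC mulVf ?mul1r ?mulrnAr// gt_eqF//.
congr expR.
rewrite !exprMn -mulrnAr; field.
by rewrite !gt_eqF.
Qed.

Lemma integral_normal_scale_gt0 (R : realType) (s c : R) (f : R -> R) : 0 < s -> 0 < c ->
  continuous f -> (forall y, 0 <= f y <= 1) ->
  (\int[normal_prob 0 s]_y (f (c * y))%:E = \int[normal_prob 0 (c * s)]_y (f y)%:E)%E.
Proof.
move=> s0 c0 cf f01.
have cfc : continuous (fun y => f (c * y)).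
  move=> y; apply: (continuous_comp (f := *%R c)); last exact: cf.
  exact: mulrl_continuous.
transitivity (\int[lebesgue_measure]_y (f (c * y)%R * normal_pdf 0 s y)%:E)%E.
  by apply: (integral_normal_prob R 0 s (fun y => f (c * y))) => //; exact: continuous_measurable_fun.
transitivity (\int[lebesgue_measure]_y (f y * normal_pdf 0 (c * s)%R y)%:E)%E; last first.
  by symmetry; apply: integral_normal_prob => //; exact: continuous_measurable_fun.
have dF y : derivable ( *%R c) y 1 by exact: derivableM.
have F'E : derive1 ( *%R c) = cst c.
  by apply/funext => y; rewrite derive1E deriveM// derive_id derive_cst scaler0 addr0 scaler1.
rewrite [RHS](increasing_ge0_integration_by_substitutionT (F := *%R c)
  (G := fun y => f y * normal_pdf 0 (c * s) y)).
- apply: eq_integral => y _; rewrite F'E /= !fctE -mulrA; congr (_ * _)%:E.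
  exact/esym/normal_pdf_scale.
- by move=> y z yz; rewrite ltr_pM2l.
- by rewrite F'E; exact: cst_continuous.
- by rewrite F'E; exact: is_cvg_cst.
- by rewrite F'E; exact: is_cvg_cst.
- exact: dF.
- exact/gt0_cvgMrNy.
- exact/gt0_cvgMry.
- move=> y; apply: cvgM; first exact: cf.
  by apply: continuous_normal_pdf; rewrite gt_eqF// mulr_gt0.
- by move=> y; rewrite mulr_ge0 ?normal_pdf_ge0//; have /andP[] := f01 y.
Qed.

Lemma integral_normal_sym (R : realType) (s : R) (f : R -> R) :
  s != 0 -> measurable_fun setT f -> (forall y, 0 <= f y <= 1) ->
  (\int[normal_prob 0 s]_y (f (- y))%:E = \int[normal_prob 0 s]_y (f y)%:E)%E.
Proof.
move=> s0 mf f01.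
have mfN : measurable_fun setT (f \o -%R) by apply: measurableT_comp.
rewrite !integral_normal_prob//.
pose h y := (f y * normal_pdf 0 s y)%:E.
have mh : measurable_fun setT h.
  by apply/measurable_EFinP; apply: measurable_funM => //; exact: measurable_normal_pdf.
transitivity (\int[lebesgue_measure]_y h (- y)%R)%E.
  apply: eq_integral => y _; rewrite /h; congr (_ * _)%:E.
  by rewrite !normal_pdfE// /normal_fun !subr0 sqrrN.
transitivity (\int[pushforward lebesgue_measure (-%R%R : _ -> measurableTypeR R)]_y h y)%E.
  rewrite ge0_integral_pushforward ?preimage_setT//.
  by move=> y _; rewrite lee_fin mulr_ge0 ?normal_pdf_ge0//; have /andP[] := f01 y.
by apply: eq_measure_integral => //= A mA _; exact: lebesgue_measureN.
Qed.

(** The coefficients of a simple process may be negative; the symmetry of the centred normal law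
    reduces this case to a positive factor. *)
Lemma integral_normal_scale (R : realType) (s c : R) (f : R -> R) : 0 < s -> c != 0 ->
  continuous f -> (forall y, 0 <= f y <= 1) ->
  (\int[normal_prob 0 s]_y (f (c * y))%:E = \int[normal_prob 0 (`|c| * s)]_y (f y)%:E)%E.
Proof.
move=> s0 c0 cf f01; move/lt_total: (c0) => /orP[clt|cgt].
  have Nc0 : 0 < - c by rewrite oppr_gt0.
  have cfc : continuous (fun y => f (- y)).
    by move=> y; apply: (continuous_comp (f := -%R)); [exact: oppr_continuous|exact: cf].
  have -> : `|c| = - c by exact: ltr0_norm.
  transitivity (\int[normal_prob 0 s]_y (f (- (- c * y))%R)%:E)%E.
    by apply: eq_integral => y _; rewrite mulNr opprK.
  transitivity (\int[normal_prob 0 (- c * s)]_y (f (- y)%R)%:E)%E.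
    exact: (integral_normal_scale_gt0 R s (- c) (fun y => f (- y)) s0 Nc0 cfc).
  apply: integral_normal_sym => //; last exact: continuous_measurable_fun.
  by rewrite mulf_neq0 ?lt0r_neq0// gt_eqF// .
have -> : `|c| = c by exact: gtr0_norm.
exact: integral_normal_scale_gt0.
Qed.

Lemma cvgn_ge0 (R : realType) (a : nat -> R) (t : R) :
  (forall n, 0 <= a n) -> a @ \oo --> t -> 0 <= t.
Proof.
move=> a0 at_; rewrite -(cvg_lim _ at_)//.
by apply: limr_ge; [apply/cvg_ex; exists t|exact: nearW].
Qed.

(** The sequential form in which path continuity is used below: paths are continuous only within the
    half-line, and nonnegative sequences stay inside it. *)
Lemma within_cvgn (R : realType) (f : R -> R) (a : nat -> R) (t : R) :
  {within `[0, +oo[, continuous f} ->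
  (forall n, 0 <= a n) -> a @ \oo --> t -> f (a n) @[n --> \oo] --> f t.
Proof.
move=> /subspace_continuousP cf a0 at_.
have t0 : `[0, +oo[%classic t by rewrite /= in_itv/= andbT; exact: cvgn_ge0 at_.
apply: cvg_comp (cf t t0) => B; rewrite /within/= => nB.
have := at_ _ nB; rewrite !nbhs_simpl/=; apply: filterS => n; apply.
by rewrite in_itv/= a0.
Qed.

(** * Brownian increments and the heat semigroup *)

Section UnitExpectation.
Context {R : realType} {d : measure_display} {T : measurableType d} (P : probability T R).

Lemma expectation01 (f : T -> R) : measurable_fun setT f -> (forall w, 0 <= f w <= 1) ->
  (0 <= \int[P]_w (f w)%:E <= 1)%E.
Proof.
move=> mf f01; apply/andP; split.
  by apply: integral_ge0 => w _; rewrite lee_fin; have /andP[] := f01 w.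
rewrite [leRHS](_ : _ = \int[P]_w (cst 1 w))%E; last first.
  by rewrite integral_cst//= [P setT]probability_setT mul1e.
apply: ge0_le_integral => //.
- by move=> w _; rewrite lee_fin; have /andP[] := f01 w.
- exact/measurable_EFinP.
- by move=> w _; rewrite lee_fin; have /andP[] := f01 w.
Qed.

Lemma expectation01_fineK (f : T -> R) : measurable_fun setT f -> (forall w, 0 <= f w <= 1) ->
  (fine (\int[P]_w (f w)%:E))%:E = (\int[P]_w (f w)%:E)%E.
Proof.
move=> mf f01; have /andP[h1 h2] := expectation01 f mf f01.
by rewrite fineK// ge0_fin_numE// (le_lt_trans h2)// ltry.
Qed.

End UnitExpectation.

Lemma cvgn_continuous (R : realType) (f : R -> R) (x : R) :
  (forall u : nat -> R, u @ \oo --> x -> f (u n) @[n --> \oo] --> f x) ->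
  {for x, continuous f}.
Proof.
move=> H; apply: contrapT => /cvgrPdist_lt /existsNP[e /not_implyP[e0 ne]].
have /choice[u uP] : forall n : nat, exists y, `|x - y| < n.+1%:R^-1 /\ e <= `|f x - f y|.
  move=> n; apply: contrapT => /forallNP H'; apply: ne.
  exists n.+1%:R^-1 => //=.
  move=> y /= xy; rewrite ltNge; apply/negP => h; exact: (H' y).
have /H/cvgrPdist_lt/(_ e e0)[N _ HN] : u @ \oo --> x.
  apply/cvgrPdist_lt => eps eps0.
  have [N _ HN] := near_infty_natSinv_lt (PosNum eps0).
  by exists N => // n /= Nn; apply: lt_trans (HN n Nn); have [] := uP n.
have := HN N (leqnn N); rewrite /= ltNge; have [_ ->] := uP N.
by [].
Qed.

Definition unit_continuous {R : realType} (g : R -> R) : Prop :=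
  continuous g /\ forall y, 0 <= g y <= 1.

Section Heat.
Context {R : realType} {d : measure_display} {Omega : measurableType d}.
Variables (P : probability Omega R) (F : R -> set (set Omega)) (W : R -> Omega -> R).
Hypotheses (hF : is_filtration F) (hW : brownian_motion F P W).

Lemma filtration_sigma t : 0 <= t -> sigma_algebra setT (F t).
Proof. by case: hF => h _ _; exact: h. Qed.

Lemma filtration_sub t : 0 <= t -> F t `<=` measurable.
Proof. by case: hF => _ h _; exact: h. Qed.

Lemma measurable_wrt_measurable t (f : Omega -> R) : 0 <= t ->
  measurable_wrt (F t) f -> measurable_fun setT f.
Proof.
move=> t0 mf.
apply: (measurableT_comp (f := f : g_sigma_algebraType (F t) -> R)); first exact: mf.
exact/measurable_id_g_sigma/filtration_sub.
Qed.

Lemma measurable_wrt_mono s t (f : Omega -> R) : 0 <= s -> s <= t ->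
  measurable_wrt (F s) f -> measurable_wrt (F t) f.
Proof.
move=> s0 st mf _ A mA; have := mf measurableT A mA; rewrite !setTI.
rewrite /measurable/= !sigma_algebra_id.
- by case: hF => _ _; apply.
- by apply: filtration_sigma; exact: le_trans st.
- exact: filtration_sigma.
Qed.

Lemma measurable_brownian t : 0 <= t -> measurable_fun setT (W t).
Proof. by move=> t0; apply: (measurable_wrt_measurable t) => //; case: hW => h _ _ _ _; exact: h. Qed.

Lemma measurable_brownian_incr s t : 0 <= s -> 0 <= t -> measurable_fun setT (fun w => W t w - W s w).
Proof. by move=> s0 t0; apply: measurable_funB; exact: measurable_brownian. Qed.

Lemma expectation_brownian_incr s t (f : R -> R) : 0 <= s -> s < t ->
  measurable_fun setT f -> (forall y, 0 <= f y) ->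
  (\int[P]_w (f (W t w - W s w))%:E = \int[normal_prob 0 (Num.sqrt (t - s))]_y (f y)%:E)%E.
Proof.
move=> s0 st mf f0.
have mz : measurable_fun setT ((fun w => W t w - W s w) : Omega -> measurableTypeR R).
  by apply: measurable_brownian_incr => //; exact/ltW/(le_lt_trans s0).
pose z : {mfun Omega >-> measurableTypeR R} :=
  HB.pack ((fun w => W t w - W s w) : Omega -> measurableTypeR R) (isMeasurableFun.Build _ _ _ _ _ mz).
transitivity (\int[distribution P z]_y (f y)%:E)%E.
  rewrite ge0_integral_distribution//; exact/measurable_EFinP.
apply: eq_measure_integral => A mA _.
by case: hW => _ _ _ h _; exact: h.
Qed.

(** Convolution with the centred normal law of variance [a], written as an expectation over [W]
    itself: joint continuity in [a] and [x] then follows from path continuity, and variance 0 is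
    included. The increment [W a - W 0] is taken because [W 0] vanishes only almost surely. *)
Definition heat (g : R -> R) (a x : R) : R :=
  fine (\int[P]_w (g (x + (W a w - W 0 w)))%:E).

Variables (g : R -> R) (cg : continuous g) (g01 : forall y, 0 <= g y <= 1).

Let mg : measurable_fun setT g. Proof. exact: continuous_measurable_fun. Qed.

Lemma measurable_comp_shift (f : Omega -> R) x :
  measurable_fun setT f -> measurable_fun setT (fun w => g (x + f w)).
Proof.
move=> mf; apply: (measurableT_comp (f := g) (g := fun w => x + f w)); first exact: mg.
exact: measurable_funD.
Qed.

Lemma heatE a x : 0 <= a ->
  (heat g a x)%:E = (\int[P]_w (g (x + (W a w - W 0 w)))%:E)%E.
Proof.
move=> a0; apply: expectation01_fineK => //.
by apply: measurable_comp_shift; exact: measurable_brownian_incr.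
Qed.

Lemma heat01 a x : 0 <= a -> 0 <= heat g a x <= 1.
Proof.
move=> a0; rewrite -!lee_fin heatE//; apply: expectation01 => //.
by apply: measurable_comp_shift; exact: measurable_brownian_incr.
Qed.

Lemma heat0 x : heat g 0 x = g x.
Proof.
rewrite /heat; under eq_integral do rewrite subrr addr0.
by rewrite integral_cst//= [P setT]probability_setT mule1.
Qed.

Lemma heat_cvg (a x : nat -> R) (b y : R) : (forall n, 0 <= a n) ->
  a @ \oo --> b -> x @ \oo --> y -> heat g (a n) (x n) @[n --> \oo] --> heat g b y.
Proof.
move=> a0 ab xy; have b0 : 0 <= b by exact: cvgn_ge0 ab.
apply: fine_cvg; rewrite heatE//; apply: bounded_expectation_cvg.
- by move=> n; apply: measurable_comp_shift; exact: measurable_brownian_incr.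
- by apply: measurable_comp_shift; exact: measurable_brownian_incr.
- by move=> n w; exact: g01.
- apply: aeW => w; apply: (cvg_comp (fun n => x n + (W (a n) w - W 0 w)) g _ (cg _)).
  apply: cvgD => //; apply: cvgB; last exact: cvg_cst.
  by apply: (within_cvgn _ (fun t => W t w)) => //; case: hW => _ h _ _ _; exact: h.
Qed.

Lemma measurable_heat a : 0 <= a -> measurable_fun setT (heat g a).
Proof.
move=> a0; apply: continuous_measurable_fun => x; apply: cvgn_continuous => u ux.
by apply: heat_cvg => //; exact: cvg_cst.
Qed.

(** Semigroup property. The increment [W (a + b) - W 0] is split at time [b]; given [F b], the
    second part is frozen out and has the law of an increment from 0 to [a]. *)
Lemma heat_incr a b x : 0 <= a -> 0 <= b ->
  (\int[P]_w (heat g a (x + (W b w - W 0 w)))%:E = (heat g (a + b) x)%:E)%E.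
Proof.
rewrite le_eqVlt => /orP[/eqP <-|a0] b0.
  rewrite add0r heatE//; apply: eq_integral => w _; congr EFin; exact: heat0.
have ab : b < a + b by rewrite ltrDr.
have ab0 : 0 <= a + b by rewrite addr_ge0// ltW.
have mWb t : 0 <= t -> t <= b ->
    measurable_fun setT (W t : g_sigma_algebraType (F b) -> measurableTypeR R).
  by move=> t0 tb; apply: (measurable_wrt_mono t b) => //; case: hW => h _ _ _ _; exact: h.
pose phi (p : g_sigma_algebraType (F b) * measurableTypeR R) : \bar R :=
  (g (x + (W b p.1 - W 0 p.1) + p.2))%:E.
pose zeta w := W (a + b) w - W b w.
have mphi : measurable_fun setT phi.
  apply/measurable_EFinP; apply: (measurableT_comp (f := g)); first exact: mg.
  apply: measurable_funD; last exact: measurable_snd.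
  apply: measurable_funD => //; apply: measurable_funB.
    by apply: (measurableT_comp (mWb b b0 (lexx b))).
  by apply: (measurableT_comp (mWb 0 (lexx 0) b0)).
transitivity (\int[P]_w \int[P]_v phi (w, zeta v))%E.
  apply: eq_integral => w _; rewrite heatE ?(ltW a0)// /phi /=.
  set y := x + (W b w - W 0 w).
  have my : measurable_fun setT (fun z => g (y + z)).
    apply: (measurableT_comp (f := g) (g := fun z => y + z)); first exact: mg.
    exact: measurable_funD.
  have y0 z : 0 <= g (y + z) by have /andP[] := g01 (y + z).
  have e1 := expectation_brownian_incr 0 a (fun z => g (y + z)) (lexx 0) a0 my y0.
  have e2 := expectation_brownian_incr b (a + b) (fun z => g (y + z)) b0 ab my y0.
  rewrite subr0 in e1; rewrite addrK in e2; exact: (etrans e1 (esym e2)).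
rewrite heatE//; transitivity (\int[P]_w phi (w, zeta w))%E; last first.
  apply: eq_integral => w _.
  rewrite /phi /zeta/=; congr (g _)%:E; rewrite -addrA; congr (_ + _).
  by rewrite addrC subrKA.
symmetry; apply: (freezing _ _ _ _ (F b)).
- exact: filtration_sigma.
- exact: filtration_sub.
- exact: measurable_brownian_incr.
- by move=> A B FA mB; case: hW => _ _ _ _; apply.
- exact: mphi.
- by move=> p; rewrite lee_fin; have /andP[] := g01 (x + (W b p.1 - W 0 p.1) + p.2).
Qed.

(* By Brownian scaling [c * (W t - W s)] has the law of an increment over a time
   [c ^+ 2 * (t - s)]. *)
Lemma heat_scaled_incr a c s t x : 0 <= a -> 0 <= s -> s <= t ->
  (\int[P]_w (heat g a (x + c * (W t w - W s w)))%:E =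
   (heat g (a + c ^+ 2 * (t - s)) x)%:E)%E.
Proof.
move=> a0 s0; rewrite le_eqVlt => /orP[/eqP <-|st].
  rewrite subrr mulr0 addr0; under eq_integral do rewrite subrr mulr0 addr0.
  by rewrite integral_cst//= [P setT]probability_setT mule1.
have [->|c0] := eqVneq c 0.
  rewrite expr0n mul0r addr0; under eq_integral do rewrite mul0r addr0.
  by rewrite integral_cst//= [P setT]probability_setT mule1.
have ts0 : 0 < t - s by rewrite subr_gt0.
have b0 : 0 < c ^+ 2 * (t - s) by rewrite mulr_gt0// exprn_even_gt0.
pose f y := heat g a (x + y).
have cf : continuous f.
  move=> y; apply: cvgn_continuous => u ux; apply: heat_cvg => //; first exact: cvg_cst.
  by apply: cvgD => //; exact: cvg_cst.
have f01 y : 0 <= f y <= 1 by exact: heat01.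
have cfc : continuous (fun y => f (c * y)).
  by move=> y; apply: (continuous_comp (f := *%R c)); [exact: mulrl_continuous|exact: cf].
transitivity (\int[normal_prob 0 (Num.sqrt (t - s))]_y (f (c * y)%R)%:E)%E.
  apply: (expectation_brownian_incr s t (fun y => f (c * y))) => //.
    exact: continuous_measurable_fun.
  by move=> y; have /andP[] := f01 (c * y).
transitivity (\int[normal_prob 0 (`|c| * Num.sqrt (t - s))]_y (f y)%:E)%E.
  by apply: (integral_normal_scale _ _ c f _ c0 cf f01); rewrite sqrtr_gt0.
rewrite -heat_incr ?(ltW b0)//; symmetry.
have -> : `|c| * Num.sqrt (t - s) = Num.sqrt (c ^+ 2 * (t - s) - 0).
  by rewrite subr0 sqrtrM ?sqr_ge0// sqrtr_sqr.
apply: (expectation_brownian_incr 0 _ f) => //.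
  exact: continuous_measurable_fun.
by move=> y; have /andP[] := f01 y.
Qed.

End Heat.

(** * Random walks cut into phases by their own clock *)

Section Walk.
Context {R : realType} {d : measure_display} {Omega : measurableType d}.
Variables (P : probability Omega R) (F : R -> set (set Omega)) (W : R -> Omega -> R).
Hypotheses (hF : is_filtration F) (hW : brownian_motion F P W).
Variables (s : nat -> R) (c : nat -> Omega -> R) (eta delta : R).
Hypotheses (s0 : 0 <= s 0) (s_mono : forall q, s q <= s q.+1).
Hypothesis mc : forall q, measurable_wrt (F (s q)) (c q).
Hypotheses (eta0 : 0 <= eta) (delta0 : 0 <= delta).
Hypothesis c_eta : forall q w, c q w ^+ 2 * (s q.+1 - s q) <= eta.

Definition step_var q w : R := c q w ^+ 2 * (s q.+1 - s q).

Definition step_clock q w : R := \sum_(p < q) step_var p w.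

(** The clock is read at the end of step [q], yet its value is known at time [s q], since a step
    variance involves the coefficient and the grid but no increment of [W]. This predictability is
    what allows the step to be integrated out. *)
Definition in_phase j q w : bool :=
  (j%:R * delta < step_clock q.+1 w) && (step_clock q.+1 w <= j.+1%:R * delta).

Definition phase_var j q w : R := \sum_(p < q) (in_phase j p w)%:R * step_var p w.

Definition phase_walk j q w : R :=
  \sum_(p < q) (in_phase j p w)%:R * c p w * (W (s p.+1) w - W (s p) w).

Lemma grid_ge0 q : 0 <= s q.
Proof. by elim: q => [|q IH] //; apply: le_trans (s_mono q). Qed.

Lemma grid_le p q : (p <= q)%N -> s p <= s q.
Proof.
elim: q => [|q IH]; first by rewrite leqn0 => /eqP ->.
by rewrite leq_eqVlt => /orP[/eqP ->//|]; rewrite ltnS => /IH h; apply: le_trans h (s_mono q).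
Qed.

Lemma step_var_ge0 q w : 0 <= step_var q w.
Proof. by rewrite mulr_ge0 ?sqr_ge0// subr_ge0. Qed.

Lemma step_clockS q w : step_clock q.+1 w = step_clock q w + step_var q w.
Proof. by rewrite /step_clock big_ord_recr. Qed.

Lemma in_phase_uniq i j q w : in_phase i q w -> in_phase j q w -> i = j.
Proof.
wlog ij : i j / (i <= j)%N.
  by move=> H hi hj; case: (leqP i j) => ij; [exact: H|apply/esym/H => //; exact: ltnW].
move=> /andP[_ h1] /andP[h2 _]; apply/eqP; rewrite eqn_leq ij /=.
rewrite leqNgt; apply/negP => ltij.
have : i.+1%:R * delta <= j%:R * delta by rewrite ler_wpM2r// ler_nat.
by move=> h3; have := lt_le_trans h2 (le_trans h1 h3); rewrite ltxx.
Qed.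

(* The overshoot [eta] is due to the step that enters the phase. *)
Lemma phase_var_le j q w : phase_var j q w <=
  if step_clock q w <= j%:R * delta then 0 else
    Num.min (step_clock q w) (j.+1%:R * delta) - j%:R * delta + eta.
Proof.
have jj : j%:R * delta <= j.+1%:R * delta by rewrite ler_wpM2r// ler_nat.
elim: q => [|q IH]; first by rewrite /phase_var big_ord0 /step_clock big_ord0 mulr_ge0.
rewrite /phase_var big_ord_recr/= -/(phase_var j q w).
have v0 := step_var_ge0 q w; have ve : step_var q w <= eta := c_eta q w.
move: IH; rewrite /in_phase step_clockS.
set a := step_clock q w; set v := step_var q w in v0 ve *; set u := phase_var _ _ _.
set b := j%:R * delta in jj *; set b' := j.+1%:R * delta in jj *.
rewrite !minEle; case: (ltP b (a + v)) => h2; case: (leP (a + v) b') => h3 /=;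
  case: (leP a b) => h1; rewrite ?mul1r ?mul0r ?addr0; case: (leP a b') => h4; lra.
Qed.

(** The heat semigroup will be run for this remaining time; allowing [eta] on top of [delta] absorbs
    the overshoot. *)
Lemma phase_budget_ge0 j q w : 0 <= delta + eta - phase_var j q w.
Proof.
have := phase_var_le j q w; rewrite subr_ge0.
case: ifPn => h1 h2; apply: le_trans h2 _; first by rewrite addr_ge0.
rewrite lerD2r lerBlDr ge_min; apply/orP; right.
by rewrite -(natr1 j) mulrDl mul1r addrC.
Qed.

Lemma phase_varS j q w :
  phase_var j q.+1 w = phase_var j q w + (in_phase j q w)%:R * step_var q w.
Proof. by rewrite /phase_var big_ord_recr. Qed.

Lemma phase_walkS j q w : phase_walk j q.+1 w = phase_walk j q w +
  (in_phase j q w)%:R * c q w * (W (s q.+1) w - W (s q) w).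
Proof. by rewrite /phase_walk big_ord_recr. Qed.

Lemma measurable_coef p q : (p <= q)%N -> measurable_wrt (F (s q)) (c p).
Proof. by move=> pq; apply: (measurable_wrt_mono F hF (s p)) => //; [exact: grid_ge0|exact: grid_le]. Qed.

Lemma measurable_grid_brownian p q : (p <= q)%N -> measurable_wrt (F (s q)) (W (s p)).
Proof.
move=> pq; apply: (measurable_wrt_mono F hF (s p)); [exact: grid_ge0|exact: grid_le|].
by case: hW => h _ _ _ _; apply: h; exact: grid_ge0.
Qed.

Lemma measurable_step_var p q : (p <= q)%N -> measurable_wrt (F (s q)) (step_var p).
Proof.
move=> pq; apply: measurable_funM; last exact: measurable_cst.
by apply: measurable_funX; exact: measurable_coef.
Qed.

Lemma measurable_step_clock p q : (p <= q.+1)%N -> measurable_wrt (F (s q)) (step_clock p).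
Proof.
move=> pq; apply: measurable_sum => i; apply: measurable_step_var.
by rewrite -ltnS; apply: leq_trans pq.
Qed.

Lemma measurable_in_phase j p q : (p <= q)%N ->
  measurable_wrt (F (s q)) (fun w => (in_phase j p w)%:R : R).
Proof.
move=> pq; pose A := [set w : g_sigma_algebraType (F (s q)) | j%:R * delta < step_clock p.+1 w] `&`
  [set w | step_clock p.+1 w <= j.+1%:R * delta].
have mA : measurable A.
  have ma : measurable_fun [set: g_sigma_algebraType (F (s q))] (step_clock p.+1) by exact: measurable_step_clock.
  by apply: measurableI; [exact: measurable_set_lt|exact: measurable_set_le].
rewrite /measurable_wrt (_ : (fun w => _) = \1_A); first exact: measurable_indic.
apply/funext => w; rewrite indicE /in_phase; congr (_%:R); congr nat_of_bool.
apply/idP/idP; first by move=> /andP[h1 h2]; rewrite inE.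
by rewrite inE => -[/= -> ->].
Qed.

Lemma measurable_phase_var j p q : (p <= q.+1)%N -> measurable_wrt (F (s q)) (phase_var j p).
Proof.
move=> pq; apply: measurable_sum => i.
have iq : (i <= q)%N by rewrite -ltnS; apply: leq_trans pq.
by apply: measurable_funM; [exact: measurable_in_phase|exact: measurable_step_var].
Qed.

Lemma measurable_phase_walk j q : measurable_wrt (F (s q)) (phase_walk j q).
Proof.
apply: measurable_sum => i.
apply: measurable_funM.
  by apply: measurable_funM; [apply: measurable_in_phase|apply: measurable_coef]; exact: ltnW.
by apply: measurable_funB; apply: measurable_grid_brownian => //; exact: ltnW.
Qed.

Variables (n : nat) (g : 'I_n -> R -> R).
Hypothesis hg : forall j, unit_continuous (g j).

(* A martingale in [q]: the conditional expectation of the product of the [g j] at the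
   increments of the walk if, in each phase, the part of the variance budget
   [delta + eta] not used up to step [q] is filled by an independent Brownian increment. *)
Definition walk_value q w : R :=
  \prod_j heat P W (g j) (delta + eta - phase_var j q w) (phase_walk j q w).

Lemma heat_unit j a x : 0 <= a -> 0 <= heat P W (g j) a x <= 1.
Proof. by move=> a0; have [cg g01] := hg j; exact: (heat01 P F W hF hW). Qed.

Lemma measurable_heat_subst d' (S : measurableType d') j (V J : S -> R) :
  measurable_fun setT V -> measurable_fun setT J -> (forall x, 0 <= V x) ->
  measurable_fun setT (fun x => heat P W (g j) (V x) (J x)).
Proof.
move=> mV mJ V0; have [cg g01] := hg j.
apply: (measurable_fun_time_subst _ _ _ (fun t x => heat P W (g j) t (J x))) => //.
  move=> t t0; apply: (measurableT_comp (f := heat P W (g j) t)) => //.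
  exact: (measurable_heat P F W hF hW).
move=> x a a0 ax; apply: (heat_cvg P F W hF hW) => //; exact: cvg_cst.
Qed.

Lemma walk_value01 q w : 0 <= walk_value q w <= 1.
Proof.
apply/andP; split.
  by apply: prodr_ge0 => j _; have /andP[] := heat_unit j _ (phase_walk j q w) (phase_budget_ge0 j q w).
by apply: prodr_ile1 => j _; exact/heat_unit/phase_budget_ge0.
Qed.

Lemma measurable_walk_value q : measurable_fun setT (walk_value q).
Proof.
apply: measurable_prod => j _; apply: measurable_heat_subst; last by move=> w; exact: phase_budget_ge0.
  apply: measurable_funB => //.
  by apply: (measurable_wrt_measurable F hF (s q)); [exact: grid_ge0|exact: measurable_phase_var].
by apply: (measurable_wrt_measurable F hF (s q)); [exact: grid_ge0|exact: measurable_phase_walk].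
Qed.

(** Step [q] lies in at most one phase, so at most one factor changes. After freezing at [F (s q)],
    integrating the scaled Brownian increment returns to the budget of that factor exactly the
    variance that the step takes from it. *)
Lemma walk_value_step q :
  (\int[P]_w (walk_value q.+1 w)%:E = \int[P]_w (walk_value q w)%:E)%E.
Proof.
(* Independence of increments is given for strictly ordered times only; a step of length zero
   changes neither the walk nor the budget. *)
have := s_mono q; rewrite le_eqVlt => /orP[/eqP sq|sq].
  apply: eq_integral => w _; congr EFin; apply: eq_bigr => j _.
  by rewrite phase_varS phase_walkS /step_var -sq !subrr !mulr0 !addr0.
have sq0 := grid_ge0 q.
pose G := g_sigma_algebraType (F (s q)).
pose V j (w : G) := delta + eta - phase_var j q.+1 w.
pose ic j (w : G) := (in_phase j q w)%:R * c q w.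
pose phi (p : G * measurableTypeR R) : \bar R :=
  (\prod_j heat P W (g j) (V j p.1) (phase_walk j q p.1 + ic j p.1 * p.2))%:E.
pose zeta w := W (s q.+1) w - W (s q) w.
have mphi : measurable_fun setT phi.
  apply/measurable_EFinP; apply: measurable_prod => j _; apply: measurable_heat_subst.
  - apply: (measurableT_comp (f := V j)); last exact: measurable_fst.
    by apply: measurable_funB => //; exact: measurable_phase_var.
  - apply: measurable_funD.
      by apply: (measurableT_comp (f := phase_walk j q : G -> R)); [exact: measurable_phase_walk|exact: measurable_fst].
    apply: measurable_funM; last exact: measurable_snd.
    apply: (measurableT_comp (f := ic j)); last exact: measurable_fst.
    by apply: measurable_funM; [exact: measurable_in_phase|exact: measurable_coef].
  - by move=> p; exact: phase_budget_ge0.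
transitivity (\int[P]_w phi (w, zeta w))%E.
  by apply: eq_integral => w _; congr EFin; apply: eq_bigr => j _; rewrite phase_walkS.
transitivity (\int[P]_w \int[P]_v phi (w, zeta v))%E.
  apply: (freezing _ _ _ _ (F (s q))).
  - exact: filtration_sigma.
  - exact: filtration_sub.
  - by apply: (measurable_brownian_incr P F W hF hW) => //; exact: grid_ge0.
  - by move=> A B FA mB; case: hW => _ _ _ _; apply.
  - exact: mphi.
  - move=> p; rewrite lee_fin; apply: prodr_ge0 => j _.
    by have /andP[] := heat_unit j _ (phase_walk j q p.1 + ic j p.1 * p.2) (phase_budget_ge0 j q.+1 p.1).
apply: eq_integral => w _; rewrite /phi /=.
have [[i hi]|noi] := pselect (exists i : 'I_n, in_phase i q w); last first.
  have ic0 (j : 'I_n) : in_phase j q w = false by apply/negbTE/negP => h; apply: noi; exists j.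
  rewrite (_ : (fun v => _) = cst (walk_value q w)%:E).
    by rewrite integral_cst//= [P setT]probability_setT mule1.
  apply/funext => v; congr EFin; apply: eq_bigr => j _.
  by rewrite /V /ic phase_varS ic0 !mul0r !addr0.
have icj (j : 'I_n) : j != i -> in_phase j q w = false.
  move=> ji; apply/negbTE/negP => h; move/negP: ji; apply; apply/eqP/val_inj.
  exact: (in_phase_uniq _ _ _ _ h hi).
pose C := \prod_(j < n | j != i) heat P W (g j) (delta + eta - phase_var j q w) (phase_walk j q w).
have C0 : 0 <= C.
  by apply: prodr_ge0 => j _; have /andP[] := heat_unit j _ (phase_walk j q w) (phase_budget_ge0 j q w).
have [cg g01] := hg i.
transitivity (\int[P]_v (C%:E * (heat P W (g i) (V i w) (phase_walk i q w + c q w * zeta v))%:E))%E.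
  apply: eq_integral => v _; rewrite -EFinM; congr EFin.
  rewrite (bigD1 i)//= mulrC; congr (_ * _); last by rewrite /ic hi mul1r.
  apply: eq_bigr => j ji; rewrite /V /ic phase_varS icj// !mul0r !addr0 //.
rewrite ge0_integralZl//; last 2 first.
- apply/measurable_EFinP; apply: measurable_heat_subst => //; last by move=> x; exact: phase_budget_ge0.
  apply: measurable_funD => //; apply: measurable_funM => //.
  by apply: (measurable_brownian_incr P F W hF hW) => //; exact: grid_ge0.
- move=> v _; rewrite lee_fin.
  by have /andP[] := heat_unit i _ (phase_walk i q w + c q w * zeta v) (phase_budget_ge0 i q.+1 w).
have Vi0 : 0 <= V i w by exact: phase_budget_ge0.
rewrite (heat_scaled_incr P F W hF hW (g i) cg g01 _ _ _ _ _ Vi0 sq0 (ltW sq)).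
rewrite -EFinM; congr EFin; rewrite /walk_value (bigD1 i)//= mulrC; congr (heat _ _ _ _ _ * _).
by rewrite /V phase_varS hi mul1r opprD addrA subrK.
Qed.

(** Going back to [q = 0], where every budget is full and every walk is at 0, removes all trace of
    the grid and of the coefficients. *)
Lemma expectation_walk_value q :
  (\int[P]_w (walk_value q w)%:E = (\prod_j heat P W (g j) (delta + eta) 0)%:E)%E.
Proof.
elim: q => [|q IH]; last by rewrite walk_value_step.
rewrite (_ : (fun w => _) = cst (\prod_j heat P W (g j) (delta + eta) 0)%:E).
  by rewrite integral_cst//= [P setT]probability_setT mule1.
apply/funext => w; congr EFin; apply: eq_bigr => j _.
by rewrite /phase_var /phase_walk !big_ord0 subr0.
Qed.

End Walk.

(** * Refinement of simple processes *)

(** Presents the indicator as an increment of the function sending [r] to [- (r < t)], so that the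
    values of a simple process are sums of the same shape as its integral. *)
Lemma indic_oc_diff (R : realType) (a b t : R) : a <= b ->
  \1_(`]a, b]) t = - (b < t)%R%:R - - (a < t)%R%:R :> R.
Proof.
move=> ab; rewrite indicE mem_setE in_itv/= opprK.
by case: (ltP a t) => h1; case: (ltP b t) => h2 /=; rewrite ?addNr ?oppr0 ?add0r//; exfalso; lra.
Qed.

Section Refine.
Context {R : realType}.
Variables (t : nat -> R) (M : nat).
Hypothesis M0 : (0 < M)%N.
Hypothesis t_mono : forall i, t i <= t i.+1.

Definition refine_time (q : nat) : R :=
  t (q %/ M) + (q %% M)%:R / M%:R * (t (q %/ M).+1 - t (q %/ M)).

Let M0R : (0 : R) < M%:R. Proof. by rewrite ltr0n. Qed.

Lemma refine_time_block i : refine_time (i * M) = t i.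
Proof. by rewrite /refine_time mulnK// modnMl !mul0r addr0. Qed.

Lemma refine_timeS q :
  refine_time q.+1 = refine_time q + (t (q %/ M).+1 - t (q %/ M)) / M%:R.
Proof.
have qE := divn_eq q M; have rM : (q %% M < M)%N by rewrite ltn_mod.
have [rM1|rM1] := ltnP (q %% M).+1 M.
  have -> : refine_time q.+1 =
      t (q %/ M) + (q %% M).+1%:R / M%:R * (t (q %/ M).+1 - t (q %/ M)).
    rewrite /refine_time {1 2 3 4}qE -addnS divnMDl// modnMDl.
    by rewrite (divn_small rM1) (modn_small rM1) addn0.
  rewrite /refine_time -(natr1 (q %% M)); lra.
have MM : M = (q %% M).+1 by apply/eqP; rewrite eqn_leq rM1 rM.
have -> : q.+1 = ((q %/ M).+1 * M)%N by rewrite {1}qE -addnS -MM mulSn addnC.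
rewrite refine_time_block /refine_time.
have : (q %% M)%:R + 1 = M%:R :> R by rewrite natr1 -MM.
set r := (q %% M)%:R; move=> rE.
have -> : r = M%:R - 1 by rewrite -rE addrK.
by field; rewrite gt_eqF.
Qed.

Lemma refine_time_le q : refine_time q <= refine_time q.+1.
Proof. by rewrite refine_timeS lerDl divr_ge0 ?subr_ge0// ltW. Qed.

Lemma refine_time_ge q : t (q %/ M) <= refine_time q.
Proof. by rewrite lerDl mulr_ge0 ?divr_ge0 ?subr_ge0// ltW. Qed.

(** The coefficient is constant on a block, so the increments of [G] telescope there. [G] is
    arbitrary in order to serve both the values and the integral of a simple process. *)
Lemma refine_sum (xi : nat -> R) (G : R -> R) n :
  \sum_(q < n * M) xi (q %/ M)%N * (G (refine_time q.+1) - G (refine_time q)) =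
  \sum_(i < n) xi i * (G (t i.+1) - G (t i)).
Proof.
elim: n => [|n IH]; first by rewrite mul0n !big_ord0.
rewrite big_ord_recr/= -IH mulSn addnC.
rewrite -(big_mkord xpredT (fun q => xi (q %/ M)%N * (G (refine_time q.+1) - G (refine_time q)))).
rewrite (big_cat_nat (n := n * M)%N) ?leq_addr//= big_mkord; congr (_ + _).
rewrite -{1}(add0n (n * M)%N) big_addn addnC addnK.
under eq_big_nat => q /andP[_ qM].
  rewrite addnC divnMDl// (divn_small qM) addn0 -addnS.
  over.
rewrite -big_distrr/=; congr (_ * _).
rewrite (telescope_sumr_eq (fun q => G (refine_time (n * M + q)%N)))//.
by rewrite addn0 refine_time_block addnC -mulSn refine_time_block.
Qed.

End Refine.

Section RefineProcess.
Context {R : realType} {d : measure_display} {Omega : measurableType d}.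
Variables (F : R -> set (set Omega)).
Hypotheses (hF : is_filtration F).

(** The coefficients are bounded, so a finer grid makes all step variances uniformly small, as the
    walk requires, while the process and its integral stay the same. *)
Lemma simple_process_refine (W : R -> Omega -> R) (H : @simple_process R d Omega) (eta : R) :
  simple_adapted F H -> 0 < eta ->
  exists H' : @simple_process R d Omega, [/\ simple_adapted F H',
    (forall q w, sp_coef H' q w ^+ 2 * (sp_time H' q.+1 - sp_time H' q) <= eta),
    simple_val H' = simple_val H & simple_integral W H' = simple_integral W H].
Proof.
move=> [t0 t_mono mxi bxi] eta0.
have /choice[C CP] : forall i, exists C, forall w, `|sp_coef H i w| <= C by exact: bxi.
set t := sp_time H in t0 t_mono mxi *; set N := sp_size H.
(* A sum of nonnegative terms, [B] bounds the variance of each original step; dividing a step into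
   [M > B / eta] equal parts brings it below [eta]. *)
pose B := \sum_(i < N) C i ^+ 2 * (t i.+1 - t i).
have B0 : 0 <= B by apply: sumr_ge0 => i _; rewrite mulr_ge0 ?sqr_ge0 ?subr_ge0.
pose M := (Num.trunc (B / eta)).+1.
have BM : B <= eta * M%:R.
  rewrite mulrC -ler_pdivrMr//; apply: ltW.
  by have /andP[] := truncn_itv (divr_ge0 B0 (ltW eta0)).
have M0 : (0 < M)%N by [].
have tnn i : 0 <= t i by elim: i => [//|i IH]; exact: le_trans (t_mono i).
(* The coefficients are 0 beyond the last step: the variance bound is demanded at every index, while
   [B] controls only the first [N] blocks. *)
pose H' := @SimpleProcess R d Omega (N * M)%N (refine_time t M)
  (fun q w => if (q < N * M)%N then sp_coef H (q %/ M)%N w else 0).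
have Cb i w : (i < N)%N -> sp_coef H i w ^+ 2 * (t i.+1 - t i) <= B.
  move=> iN; rewrite /B (bigD1 (Ordinal iN))//=.
  apply: ler_wpDr.
    by apply: sumr_ge0 => j _; rewrite mulr_ge0 ?sqr_ge0 ?subr_ge0.
  by rewrite ler_wpM2r ?subr_ge0// -[leLHS]real_normK ?num_real// lerXn2r ?nnegrE// (le_trans _ (CP i w)).
exists H'; split.
- split => /=.
  + by rewrite -(mul0n M) (refine_time_block t M M0).
  + by move=> q; exact: refine_time_le.
  + move=> q; case: (boolP (q < N * M)%N) => _; last exact: measurable_cst.
    by apply: (measurable_wrt_mono F hF (t (q %/ M)%N)) => //; exact: refine_time_ge.
  + by move=> q; exists `|C (q %/ M)%N| => w; case: ifP => _; rewrite ?normr0// (le_trans (CP _ _)) ?ler_norm.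
- move=> q w /=; case: ifP => qN; last by rewrite expr0n mul0r ltW.
  rewrite refine_timeS// addrAC subrr add0r mulrA ler_pdivrMr ?ltr0n//.
  by apply: le_trans BM; apply: Cb; rewrite ltn_divLR.
- apply/funext => u; apply/funext => w; rewrite /simple_val /=.
  transitivity (\sum_(q < N * M) sp_coef H (q %/ M)%N w *
     (- (refine_time t M q.+1 < u)%R%:R - - (refine_time t M q < u)%R%:R) : R).
    by apply: eq_bigr => q _; rewrite ltn_ord indic_oc_diff// refine_time_le.
  rewrite (refine_sum t M M0 (fun i => sp_coef H i w) (fun r => - (r < u)%R%:R)).
  by apply: eq_bigr => i _; rewrite indic_oc_diff.
- apply/funext => u; apply/funext => w; rewrite /simple_integral /=.
  transitivity (\sum_(q < N * M) sp_coef H (q %/ M)%N w *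
     (W (Num.min (refine_time t M q.+1) u) w - W (Num.min (refine_time t M q) u) w)).
    by apply: eq_bigr => q _; rewrite ltn_ord.
  exact: (refine_sum t M M0 (fun i => sp_coef H i w) (fun r => W (Num.min r u) w)).
Qed.

End RefineProcess.

(** * Deterministic time changes *)

Section InverseClock.
Context {R : realType}.
Variables (A T : R -> R).
Hypotheses (A0 : A 0 = 0) (A_mono : forall r t, 0 <= r -> r <= t -> A r <= A t).
Hypothesis cA : {within `[0, +oo[, continuous A}.
Hypotheses (T0 : forall t, 0 <= t -> 0 <= T t)
  (T_mono : forall r t, 0 <= r -> r <= t -> T r <= T t)
  (TA : forall t, 0 <= t -> T (A t) = t).

Lemma clock_ge0 t : 0 <= t -> 0 <= A t.
Proof. by move=> t0; rewrite -A0; exact: A_mono. Qed.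

Lemma clock_lt r t : 0 <= r -> r < t -> A r < A t.
Proof.
move=> r0 rt; rewrite lt_neqAle A_mono ?(ltW rt)// andbT; apply/negP => /eqP e.
have t0 : 0 <= t by exact: le_trans (ltW rt).
by move: rt; rewrite -(TA r)// e TA// ltxx.
Qed.

(** If [A] stayed below [a], monotonicity would give [T a + 1 = T (A (T a + 1)) <= T a]. *)
Lemma clock_unbounded a : 0 <= a -> exists2 t, 0 <= t & a <= A t.
Proof.
move=> a0; apply: contrapT => H.
have Ta0 := T0 a a0.
have t0 : 0 <= T a + 1 by rewrite addr_ge0.
have h : A (T a + 1) <= a.
  by rewrite leNgt; apply/negP => h; apply: H; exists (T a + 1) => //; exact: ltW.
have := T_mono _ _ (clock_ge0 _ t0) h; rewrite TA//.
by rewrite gerDl ler10.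
Qed.

Lemma clockK a : 0 <= a -> A (T a) = a.
Proof.
move=> a0; have [t t0 at_] := clock_unbounded a a0.
have cAt : {within `[0, t], continuous A}.
  by apply: continuous_subspaceW cA => x /=; rewrite !in_itv/= andbT => /andP[].
have [u /[!in_itv]/= /andP[u0 ut] <-] : exists2 u, u \in `[0, t] & A u = a.
  apply: IVT => //; rewrite A0; rewrite ?min_l ?max_r ?clock_ge0//.
  by rewrite a0 at_.
by rewrite TA.
Qed.

(** [A] is strictly increasing, so [A (T a - e) < a < A (T a + e)] traps [u n]. The hypothesis
    concerns the clock values only, because grid times are located through their clock values;
    continuity of [T] is the special case [u n = T (a n)]. *)
Lemma inverse_clock_cvg (u : nat -> R) a : (forall n, 0 <= u n) ->
  A (u n) @[n --> \oo] --> a -> u @ \oo --> T a.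
Proof.
move=> u0 ua; have a0 : 0 <= a by apply: cvgn_ge0 ua => n; exact: clock_ge0.
have Ta0 := T0 a a0.
apply/cvgrPdist_lt => e e0.
have lo : \forall n \near \oo, T a - e < u n.
  have [Te|Te] := ltP (T a - e) 0; first by apply: nearW => n; exact: lt_le_trans (u0 n).
  have h1 : A (T a - e) < a by rewrite -[X in _ < X](clockK a)// clock_lt// gtrBl.
  apply: filterS (cvgr_gt a ua _ h1) => n; rewrite !ltNge; apply: contra => h.
  exact: A_mono.
have h1 : a < A (T a + e) by rewrite -[X in X < _](clockK a)// clock_lt// ltrDl.
have hi : \forall n \near \oo, u n < T a + e.
  apply: filterS (cvgr_lt a ua _ h1) => n; rewrite !ltNge; apply: contra => h.
  by apply: A_mono => //; rewrite addr_ge0// ltW.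
near=> n; rewrite distrC ltr_distl; apply/andP; split; near: n; [exact: lo|exact: hi].
Unshelve. all: by end_near. Qed.

Lemma inverse_clock_continuous (a : nat -> R) b : (forall n, 0 <= a n) ->
  a @ \oo --> b -> T (a n) @[n --> \oo] --> T b.
Proof.
move=> a0 ab; apply: inverse_clock_cvg => [n|]; first exact: T0.
by under eq_fun do rewrite clockK//.
Qed.

End InverseClock.

(** * Convergence of the discrete phases along one fixed path *)

Section PathLimit.
Context {R : realType}.

Lemma nondecreasing_threshold (b : nat -> R) (tau : R) n :
  (forall p, b p <= b p.+1) ->
  exists2 h, (h <= n)%N & forall p, (p < n)%N -> (b p <= tau) = (p < h)%N.
Proof.
move=> bm; have bm' p q : (p <= q)%N -> b p <= b q.
  by move/subnK <-; elim: (q - p)%N => [|r IH]; rewrite ?add0n// addSn (le_trans IH).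
elim: n => [|n [h hn IH]]; first by exists 0%N.
have [bn|bn] := leP (b n) tau.
  exists n.+1 => // p pn; rewrite pn; apply: le_trans bn; exact: bm'.
exists h; first exact: leqW.
move=> p; rewrite ltnS leq_eqVlt => /orP[/eqP ->|]; last exact: IH.
by rewrite leNgt bn ltnNge hn.
Qed.

Lemma sum_threshold (f : nat -> R) (B : nat -> bool) h n : (h <= n)%N ->
  (forall p, (p < n)%N -> B p = (p < h)%N) ->
  \sum_(p < n) (B p)%:R * f p = \sum_(p < h) f p.
Proof.
move=> hn BE; rewrite (big_ord_widen n (fun p => f p) hn) [RHS]big_mkcond/=.
by apply: eq_bigr => p _; rewrite BE//; case: ifP; rewrite ?mul1r ?mul0r.
Qed.

Variables (s v x : nat -> nat -> R) (N : nat -> nat) (a S : nat -> R -> R) (eta : nat -> R).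
Variables (A I T : R -> R).
Hypotheses (s0 : forall k p, 0 <= s k p) (s_mono : forall k p, s k p <= s k p.+1)
  (v0 : forall k p, 0 <= v k p) (v_eta : forall k p, v k p <= eta k)
  (eta0 : forall k, 0 <= eta k) (eta_cvg : eta @ \oo --> 0).
Hypotheses (a_grid : forall k q, (q <= N k)%N -> a k (s k q) = \sum_(p < q) v k p)
  (a_mono : forall k r t, 0 <= r -> r <= t -> a k r <= a k t)
  (a_le : forall k t, a k t <= \sum_(p < N k) v k p)
  (S_grid : forall k q, (q <= N k)%N -> S k (s k q) = \sum_(p < q) x k p).
Hypotheses (A_inf : forall t, 0 <= t -> exists2 r, 0 <= r & t <= A r)
  (T_cvg : forall (u : nat -> R) b, (forall n, 0 <= u n) ->
     A (u n) @[n --> \oo] --> b -> u @ \oo --> T b)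
  (cI : {within `[0, +oo[, continuous I}).
Hypothesis good : \forall k \near \oo, forall t, 0 <= t <= k%:R ->
  [/\ `|S k t - I t| <= eta k, a k t <= (1 + eta k) * A t + 2 * eta k
    & A t <= (1 + eta k) * a k t + 2 * eta k].

(** Here [v k] and [x k] stand for the step variances and step increments of the [k]-th walk, [a k]
    and [S k] for the clock and the integral of the [k]-th simple process in continuous time, and
    [A] and [I] for their limits. Both sums stop at the grid time where the discrete clock is about
    to pass [tau]. *)
Lemma path_limit tau : 0 <= tau ->
  \sum_(p < N k) (\sum_(r < p.+1) v k r <= tau)%R%:R * x k p @[k --> \oo] --> I (T tau) /\
  \sum_(p < N k) (\sum_(r < p.+1) v k r <= tau)%R%:R * v k p @[k --> \oo] --> tau.
Proof.
move=> tau0.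
have bm k p : \sum_(r < p.+1) v k r <= \sum_(r < p.+2) v k r.
  by rewrite [leRHS]big_ord_recr/= lerDl.
have /choice[h hP] : forall k, exists h, (h <= N k)%N /\ forall p, (p < N k)%N ->
    (\sum_(r < p.+1) v k r <= tau) = (p < h)%N.
  by move=> k; have [h hN hE] := nondecreasing_threshold _ tau (N k) (bm k); exists h.
have sumE (f : nat -> nat -> R) k :
    \sum_(p < N k) (\sum_(r < p.+1) v k r <= tau)%R%:R * f k p = \sum_(p < h k) f k p.
  by have [hN hE] := hP k; exact: (sum_threshold (f k) (fun p => \sum_(r < p.+1) v k r <= tau)%R).
have ah_le k : \sum_(p < h k) v k p <= tau.
  have [hN hE] := hP k; case E : (h k) => [|h']; first by rewrite big_ord0.
  by rewrite hE -?E.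
(* [h k] is the last step before the discrete clock exceeds [tau]: its clock value
   tends to [tau], hence its grid time [s k (h k)] tends to [T tau]. *)
have [t1 t10 At1] := A_inf (tau + 1) (addr_ge0 tau0 ler01).
(* If [a k t1 <= tau], the comparison of clocks gives [A t1 <= tau + eta k * (tau + 2)], which
   contradicts [tau + 1 <= A t1] once [eta k < (tau + 2)^-1]. *)
have tau2 : 0 < (tau + 2)^-1 by rewrite invr_gt0; lra.
have reach : \forall k \near \oo, t1 <= k%:R /\ tau < a k t1.
  near=> k.
  have kt : t1 <= k%:R by near: k; exact: nbhs_infty_ger.
  have ek : eta k < (tau + 2)^-1 by near: k; exact: (cvgr_lt _ eta_cvg).
  have gk : forall t, 0 <= t <= k%:R -> [/\ `|S k t - I t| <= eta k,
    a k t <= (1 + eta k) * A t + 2 * eta k & A t <= (1 + eta k) * a k t + 2 * eta k].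
    by near: k; exact: good.
  split => //; rewrite ltNge; apply/negP => le.
  have [|_ _ h2] := gk t1; first by rewrite t10.
  move: ek; rewrite -[X in _ < X]mul1r ltr_pdivlMr; last lra.
  have : (1 + eta k) * a k t1 <= (1 + eta k) * tau by rewrite ler_wpM2l// addr_ge0.
  by move=> h3 h4; have := eta0 k; lra.
have s_mono' k p q : (p <= q)%N -> s k p <= s k q.
  by move/subnK <-; elim: (q - p)%N => [|r IH]; rewrite ?add0n// addSn (le_trans IH).
have hiP : \forall k \near \oo, [/\
    `|S k (s k (h k)) - I (s k (h k))| <= eta k,
    tau - eta k <= \sum_(p < h k) v k p,
    \sum_(p < h k) v k p <= (1 + eta k) * A (s k (h k)) + 2 * eta k
    & A (s k (h k)) <= (1 + eta k) * \sum_(p < h k) v k p + 2 * eta k].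
  apply: filterS2 reach good => k [kt rk] gk; have [hN hE] := hP k.
  have hlt : (h k < N k)%N.
    rewrite ltnNge; apply/negP => Nh.
    have /eqP hkN : h k == N k by rewrite eqn_leq hN.
    have := le_trans (ltW rk) (a_le k t1); have := ah_le k; rewrite hkN => h1 h2.
    have := lt_le_trans rk (a_le k t1); rewrite ltNge; move/negP; apply; exact: h1.
  have sk : s k (h k) <= t1.
    rewrite leNgt; apply/negP => lt; have := a_mono k _ _ t10 (ltW lt).
    by rewrite a_grid// leNgt (le_lt_trans (ah_le k) rk).
  have [|g1 g2 g3] := gk (s k (h k)); first by rewrite s0/= (le_trans sk).
  rewrite -a_grid//; split => //; rewrite a_grid//.
  (* Step [h k] takes the clock past [tau] and has variance at most [eta k], hence the lower bound
     [tau - eta k] just before it. *)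
  have : ~~ (\sum_(r < (h k).+1) v k r <= tau) by rewrite hE// ltnn.
  rewrite -ltNge big_ord_recr/= => h1; have := v_eta k (h k); lra.
have a_lim : \sum_(p < h k) v k p @[k --> \oo] --> tau.
  apply: (@squeeze_cvgr _ _ _ _ (fun k => tau - eta k) (cst tau)).
  - by apply: filterS hiP => k [_ -> _ _] /=; rewrite ah_le.
  - by rewrite -[X in _ --> X]subr0; apply: cvgB => //; exact: cvg_cst.
  - exact: cvg_cst.
have A_lim : A (s k (h k)) @[k --> \oo] --> tau.
  apply: (@squeeze_cvgr _ _ _ _ (fun k => (\sum_(p < h k) v k p - 2 * eta k) / (1 + eta k))
     (fun k => (1 + eta k) * \sum_(p < h k) v k p + 2 * eta k)).
  - apply: filterS hiP => k [_ _ h1 h2] /=; rewrite h2 andbT ler_pdivrMr ?ltr_pwDl//.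
    by rewrite lerBlDr mulrC.
  - rewrite -[X in _ --> X](_ : (tau - 2 * 0) / (1 + 0) = tau); last by field.
    apply: cvgM; first by apply: cvgB => //; apply: cvgM => //; exact: cvg_cst.
    by apply: cvgV; [rewrite addr0 oner_neq0|apply: cvgD => //; exact: cvg_cst].
  - rewrite -[X in _ --> X](_ : (1 + 0) * tau + 2 * 0 = tau); last by ring.
    apply: cvgD; last by apply: cvgM => //; exact: cvg_cst.
    by apply: cvgM => //; apply: cvgD => //; exact: cvg_cst.
have s_lim := T_cvg (fun k => s k (h k)) tau (fun k => s0 k (h k)) A_lim.
have I_lim := within_cvgn _ I (fun k => s k (h k)) (T tau) cI (fun k => s0 k (h k)) s_lim.
split; last first.
  by apply: cvg_trans a_lim; apply: near_eq_cvg; apply: nearW => k; rewrite sumE.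
apply: (@squeeze_cvgr _ _ _ _ (fun k => I (s k (h k)) - eta k) (fun k => I (s k (h k)) + eta k)).
- apply: filterS hiP => k [h1 _ _ _]; rewrite sumE -S_grid; last by have [] := hP k.
  by rewrite -ler_distl.
- by rewrite -[X in _ --> X]subr0; apply: cvgB.
- by rewrite -[X in _ --> X]addr0; apply: cvgD.
Unshelve. all: by end_near. Qed.

End PathLimit.

(** * Approximation of the clock and of the stochastic integral *)

Section Progressive.
Context {R : realType} {d : measure_display} {Omega : measurableType d}.
Variables (F : R -> set (set Omega)).
Hypotheses (hF : is_filtration F).

Lemma progressive_measurable Z t : progressive F Z -> 0 <= t ->
  measurable_fun (`[0, t] `*` setT : set (measurableTypeR R * Omega))
    (fun p => Z p.1 p.2 : measurableTypeR R).
Proof.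
move=> pZ t0; have mZ := pZ t t0.
pose i (p : measurableTypeR R * Omega) : measurableTypeR R * g_sigma_algebraType (F t) := (p.1, p.2).
have mi : measurable_fun setT i.
  have m1 : measurable_fun setT (fun p : measurableTypeR R * Omega => p.1) by exact: measurable_fst.
  have m2 : measurable_fun setT
      ((fun p => p.2) : measurableTypeR R * Omega -> g_sigma_algebraType (F t)).
    apply: (measurableT_comp (f := (fun x => x) : Omega -> g_sigma_algebraType (F t))).
      by apply: measurable_id_g_sigma; exact: filtration_sub.
    exact: measurable_snd.
  exact: (measurable_fun_pair m1 m2).
have mD : measurable (`[0, t] `*` setT : set (measurableTypeR R * g_sigma_algebraType (F t))).
  exact: measurableX.
apply: (measurable_comp mD _ mZ (g := i)); last exact: measurable_funTS.
by move=> _ [p /= h <-].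
Qed.

Lemma progressive_section Z t w : progressive F Z -> 0 <= t ->
  measurable_fun (`[0, t] : set (measurableTypeR R)) (fun u => Z u w : measurableTypeR R).
Proof.
move=> pZ t0.
have mD : measurable (`[0, t] `*` setT : set (measurableTypeR R * Omega)).
  exact: measurableX.
apply: (measurable_comp mD _ (progressive_measurable Z t pZ t0)
  (g := fun u : measurableTypeR R => (u, w))); first by move=> _ [p /= h <-].
by apply: measurable_funTS; apply: measurable_fun_pair => //; exact: measurable_cst.
Qed.

End Progressive.

(** * The clock of a simple process and its distance to the clock of the integrand *)

Section SimpleValue.
Context {R : realType} {d : measure_display} {Omega : measurableType d}.
Variables (H : @simple_process R d Omega).
Local Notation s := (sp_time H).
Local Notation c := (sp_coef H).
Hypotheses (s0 : 0 <= s 0) (s_mono : forall q, s q <= s q.+1).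

Definition simple_clock (t : R) (w : Omega) : R :=
  \sum_(q < sp_size H) c q w ^+ 2 * (Num.min (s q.+1) t - Num.min (s q) t).

Let s_le p q : (p <= q)%N -> s p <= s q.
Proof. by move/subnK <-; elim: (q - p)%N => [|r IH]; rewrite ?add0n// addSn (le_trans IH). Qed.

(** The cross terms vanish because the intervals are disjoint. *)
Lemma simple_val_sqr t w : simple_val H t w ^+ 2 =
  \sum_(q < sp_size H) c q w ^+ 2 * \1_(`]s q, s q.+1]) t.
Proof.
rewrite /simple_val; elim: (sp_size H) => [|n IH]; first by rewrite !big_ord0 expr0n.
rewrite !big_ord_recr/= sqrrD IH exprMn.
have [h|h] := pselect (`]s n, s n.+1]%classic t); last first.
  by rewrite !indicE (memNset h) !mulr0 mul0rn addr0 expr0n mulr0 addr0.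
rewrite (_ : \sum_(q < n) c q w * _ = 0); last first.
  rewrite big1// => q _; rewrite indicE memNset ?mulr0//= in_itv/= => /andP[_ h2].
  move: h; rewrite /= in_itv/= => /andP[h1 _]; have := le_lt_trans (le_trans h2 (s_le _ _ (ltn_ord q))) h1.
  by rewrite ltxx.
by rewrite mul0r mul0rn addr0 indicE mem_set// expr1n.
Qed.

Lemma integral_simple_val_sqr t w : 0 <= t ->
  (\int[lebesgue_measure]_(u in `[0%R, t]) (simple_val H u w ^+ 2)%:E = (simple_clock t w)%:E)%E.
Proof.
move=> t0.
transitivity (\sum_(q < sp_size H) \int[lebesgue_measure]_(u in `[0%R, t])
    ((c q w ^+ 2)%:E * (\1_(`]s q, s q.+1]) u)%:E))%E.
  rewrite -ge0_integral_sum//; last 2 first.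
  - move=> q; apply/measurable_EFinP; apply: measurable_funM => //.
  - by move=> q u _; rewrite lee_fin mulr_ge0 ?sqr_ge0.
  by apply: eq_integral => u _; rewrite simple_val_sqr -sumEFin.
rewrite /simple_clock -sumEFin; apply: eq_bigr => q _.
rewrite ge0_integralZl//; last 2 first.
- by apply/measurable_EFinP; exact: measurable_indic.
- by rewrite lee_fin sqr_ge0.
rewrite integral_indic// [RHS]EFinM; congr (_ * _)%E.
have sq0 : 0 <= s q by apply: le_trans s0 (s_le 0 q _).
rewrite (_ : _ `&` _ = `]Num.min (s q) t, Num.min (s q.+1) t]%classic).
  rewrite /= lebesgue_measure_itv/= lte_fin; case: ltP => // h.
  rewrite -[LHS]/(0%R%:E); congr EFin; apply/esym/eqP; rewrite subr_eq0 eq_le h/=.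
  by rewrite le_min !ge_min lexx orbT !andbT (s_mono q).
apply/seteqP; split => u /=; rewrite !in_itv/=.
  by move=> [/andP[h1 h2] /andP[h3 h4]]; rewrite gt_min h1/= le_min h2 h4.
rewrite gt_min le_min => /andP[h1 /andP[h2 h3]].
have h4 : s q < u by case/orP: h1 => // h1; have := lt_le_trans h1 h3; rewrite ltxx.
by rewrite h4 h2 h3 (le_trans sq0)// ltW.
Qed.

Lemma simple_clock_grid q w : (q <= sp_size H)%N ->
  simple_clock (s q) w = \sum_(p < q) c p w ^+ 2 * (s p.+1 - s p).
Proof.
move=> qN; rewrite (big_ord_widen _ (fun p => c p w ^+ 2 * (s p.+1 - s p)) qN).
rewrite [RHS]big_mkcond/=; apply: eq_bigr => p _; case: ifP => pq.
  by rewrite !min_l// s_le// ltnW.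
have qp : (q <= p)%N by rewrite leqNgt pq.
by rewrite !min_r ?subrr ?mulr0// s_le// leqW.
Qed.

Lemma simple_integral_grid W q w : (q <= sp_size H)%N ->
  simple_integral W H (s q) w = \sum_(p < q) c p w * (W (s p.+1) w - W (s p) w).
Proof.
move=> qN; rewrite (big_ord_widen _ (fun p => c p w * (W (s p.+1) w - W (s p) w)) qN).
rewrite [RHS]big_mkcond/=; apply: eq_bigr => p _; case: ifP => pq.
  by rewrite !min_l// s_le// ltnW.
have qp : (q <= p)%N by rewrite leqNgt pq.
by rewrite !min_r ?subrr ?mulr0// s_le// leqW.
Qed.

Lemma simple_clock_total t w :
  simple_clock t w <= \sum_(p < sp_size H) c p w ^+ 2 * (s p.+1 - s p).
Proof.
apply: ler_sum => p _; rewrite ler_wpM2l ?sqr_ge0// !minEle.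
by have sp := s_mono p; case: (leP (s p.+1) t) => h1; case: (leP (s p) t) => h2; lra.
Qed.

Lemma simple_clock_mono r t w : r <= t -> simple_clock r w <= simple_clock t w.
Proof.
move=> rt; apply: ler_sum => p _; rewrite ler_wpM2l ?sqr_ge0// !minEle.
have sp := s_mono p; case: (leP (s p.+1) r) => h1; case: (leP (s p) r) => h2;
  case: (leP (s p.+1) t) => h3; case: (leP (s p) t) => h4; lra.
Qed.

Lemma measurable_simple_val w : measurable_fun setT (fun u => simple_val H u w).
Proof.
apply: measurable_sum => q; apply: measurable_funM => //; exact: measurable_indic.
Qed.

(** Integrates [f^2 <= (1 + eta) g^2 + (1 + 1/eta) (f - g)^2] with the two processes in either role.
    A squared distance of at most [eta^2] contributes [eta^2 + eta <= 2 eta], which explains the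
    squared tolerance. *)
Lemma simple_clock_compare (sigma : R -> R) (K t eta : R) w :
  0 <= t -> t <= K -> 0 < eta -> eta <= 1 ->
  measurable_fun (`[0, K] : set (measurableTypeR R)) (sigma : R -> measurableTypeR R) ->
  (\int[lebesgue_measure]_(u in `[0%R, K]) (sigma u ^+ 2)%:E < +oo)%E ->
  (\int[lebesgue_measure]_(u in `[0%R, K]) ((simple_val H u w - sigma u) ^+ 2)%:E
     <= (eta ^+ 2)%:E)%E ->
  let A := \int[lebesgue_measure]_(u in `[0, t]) (sigma u ^+ 2) in
  simple_clock t w <= (1 + eta) * A + 2 * eta /\
  A <= (1 + eta) * simple_clock t w + 2 * eta.
Proof.
move=> t0 tK eta0 eta1 msK sigfin dist A.
have tKs : `[0, t]%classic `<=` `[0, K]%classic.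
  by move=> u /=; rewrite !in_itv/= => /andP[-> /le_trans ->].
have ms : measurable_fun (`[0, t] : set (measurableTypeR R)) (sigma : R -> measurableTypeR R).
  by apply: measurable_funS msK.
have mH : measurable_fun (`[0, t] : set (measurableTypeR R))
    ((fun u => simple_val H u w) : R -> measurableTypeR R).
  by apply: measurable_funTS; exact: measurable_simple_val.
have mS2 : measurable_fun (`[0, t] : set (measurableTypeR R)) (fun u => (sigma u ^+ 2)%:E).
  by apply/measurable_EFinP; exact: measurable_funX.
have mH2 : measurable_fun (`[0, t] : set (measurableTypeR R)) (fun u => (simple_val H u w ^+ 2)%:E).
  by apply/measurable_EFinP; exact: measurable_funX.
have mD : measurable_fun (`[0, t] : set (measurableTypeR R))
    (fun u => ((simple_val H u w - sigma u) ^+ 2)%:E).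
  by apply/measurable_EFinP; apply: measurable_funX; exact: measurable_funB.
have mDK : measurable_fun (`[0, K] : set (measurableTypeR R))
    (fun u => ((simple_val H u w - sigma u) ^+ 2)%:E).
  apply/measurable_EFinP; apply: measurable_funX; apply: measurable_funB => //.
  by apply: measurable_funTS; exact: measurable_simple_val.
have AE : (\int[lebesgue_measure]_(u in `[0%R, t]) (sigma u ^+ 2)%:E = A%:E)%E.
  rewrite /A /Rintegral fineK// ge0_fin_numE; last first.
    by apply: integral_ge0 => u _; rewrite lee_fin sqr_ge0.
  apply: le_lt_trans sigfin; apply: ge0_subset_integral => //.
    by apply/measurable_EFinP; exact: measurable_funX.
  by move=> u _; rewrite lee_fin sqr_ge0.
have distt : (\int[lebesgue_measure]_(u in `[0%R, t]) ((simple_val H u w - sigma u) ^+ 2)%:E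
    <= (eta ^+ 2)%:E)%E.
  apply: le_trans dist; apply: ge0_subset_integral => //.
  by move=> u _; rewrite lee_fin sqr_ge0.
have key (f g : R -> R) : measurable_fun (`[0, t] : set (measurableTypeR R)) (fun u => (f u ^+ 2)%:E) ->
    measurable_fun (`[0, t] : set (measurableTypeR R)) (fun u => (g u ^+ 2)%:E) ->
    (forall u, (f u - g u) ^+ 2 = (simple_val H u w - sigma u) ^+ 2) ->
    (\int[lebesgue_measure]_(u in `[0%R, t]) (f u ^+ 2)%:E <=
     (1 + eta)%:E * \int[lebesgue_measure]_(u in `[0%R, t]) (g u ^+ 2)%:E + (2 * eta)%:E)%E.
  move=> mf mg fg.
  have e0 : 0 <= 1 + eta by rewrite addr_ge0// ltW.
  have e1 : 0 <= 1 + eta^-1 by rewrite addr_ge0// invr_ge0 ltW.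
  apply: (@le_trans _ _ (\int[lebesgue_measure]_(u in `[0%R, t])
     ((1 + eta)%:E * (g u ^+ 2)%:E + (1 + eta^-1)%:E * ((simple_val H u w - sigma u) ^+ 2)%:E))%E).
    apply: ge0_le_integral => //.
    - by move=> u _; rewrite lee_fin sqr_ge0.
    - by apply: emeasurable_funD; exact: measurable_funeM.
    - move=> u _; rewrite -!EFinM -EFinD lee_fin -fg.
      (* AM-GM: [2 g (f - g) <= eta g^2 + (f - g)^2 / eta] *)
      have : 0 <= (Num.sqrt eta * g u - Num.sqrt eta^-1 * (f u - g u)) ^+ 2 by exact: sqr_ge0.
      rewrite sqrrB !exprMn !sqr_sqrtr ?invr_ge0 ?(ltW eta0)//.
      have -> : Num.sqrt eta * g u * (Num.sqrt eta^-1 * (f u - g u)) = g u * (f u - g u).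
        rewrite mulrACA -sqrtrM ?(ltW eta0)// divff ?gt_eqF// sqrtr1 mul1r //.
      nra.
  rewrite ge0_integralD//; last 4 first.
  - by move=> u _; rewrite -EFinM lee_fin mulr_ge0 ?sqr_ge0.
  - exact: measurable_funeM.
  - by move=> u _; rewrite -EFinM lee_fin mulr_ge0 ?sqr_ge0.
  - exact: measurable_funeM.
  rewrite !ge0_integralZl//; try by move=> u _; rewrite lee_fin sqr_ge0.
  rewrite leeD2l//.
  apply: (@le_trans _ _ ((1 + eta^-1)%:E * (eta ^+ 2)%:E)%E); first by rewrite lee_wpmul2l.
  rewrite -EFinM lee_fin mulrDl mul1r expr2 mulrA mulVf ?gt_eqF// mul1r.
  nra.
split.
  have := key (fun u => simple_val H u w) sigma mH2 mS2 (fun u => erefl).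
  by rewrite integral_simple_val_sqr// AE -EFinM -EFinD lee_fin.
have := key sigma (fun u => simple_val H u w) mS2 mH2.
rewrite integral_simple_val_sqr// AE -EFinM -EFinD lee_fin; apply => u.
by rewrite -sqrrN opprB.
Qed.

End SimpleValue.

Section IntegralPaths.
Context {R : realType}.
Variable (f : R -> R).
Hypothesis intf : forall t, 0 <= t -> lebesgue_measure.-integrable `[0, t] (EFin \o f).

Lemma Rintegral_nonneg_mono r t : 0 <= r -> r <= t -> (forall u, 0 <= u -> 0 <= f u) ->
  \int[lebesgue_measure]_(u in `[0, r]) f u <= \int[lebesgue_measure]_(u in `[0, t]) f u.
Proof.
move=> r0 rt f0; have t0 := le_trans r0 rt.
have fin s : 0 <= s -> (\int[lebesgue_measure]_(u in `[0%R, s]) (f u)%:E)%E \is a fin_num.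
  by move=> s0; apply: integrable_fin_num => //; exact: intf.
rewrite /Rintegral fine_le ?fin//.
apply: ge0_subset_integral => //.
- exact: measurable_int (intf t t0).
- by move=> u /=; rewrite in_itv/= => /andP[u0 _]; rewrite lee_fin f0.
- by move=> u /=; rewrite !in_itv/= => /andP[-> /le_trans ->].
Qed.

Lemma Rintegral_continuous_halfline :
  {within `[0, +oo[, continuous (fun t => \int[lebesgue_measure]_(u in `[0, t]) f u)}.
Proof.
apply/subspace_continuousP => t; rewrite /= in_itv/= andbT => t0 B nB.
have t1 : 0 <= t + 1 by rewrite addr_ge0.
have := parameterized_integral_continuous t1 (intf _ t1).
move=> /subspace_continuousP/(_ t); rewrite /= in_itv/= t0 lerDl ler01 => /(_ isT B nB).
rewrite /within/= !nbhs_simpl/= => H.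
near=> u => u0; have h : u <= t + 1.
  by near: u; apply: lt_le_nbhsl; rewrite ltrDl.
move: u0; rewrite in_itv/= andbT => u0.
have : 0 <= u <= t + 1 -> B (\int[lebesgue_measure]_(v in `[0, u]) f v).
  near: u; exact: H.
by apply; rewrite u0.
Unshelve. all: by end_near. Qed.

End IntegralPaths.

Lemma cvg_sumr (R : realType) (I : Type) (r : seq I) (f : I -> nat -> R) (l : I -> R) :
  (forall i, f i k @[k --> \oo] --> l i) ->
  \sum_(i <- r) f i k @[k --> \oo] --> \sum_(i <- r) l i.
Proof.
move=> fl; elim: r => [|i r IH].
  by rewrite big_nil; under eq_fun do rewrite big_nil; exact: cvg_cst.
rewrite big_cons; under eq_fun do rewrite big_cons.
by apply: cvgD.
Qed.

(** * Measurability of the events where the approximation is bad *)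

Section Events.
Context {R : realType} {d : measure_display} {Omega : measurableType d}.
Variables (P : probability Omega R) (F : R -> set (set Omega)) (W : R -> Omega -> R).
Hypotheses (hF : is_filtration F) (hW : brownian_motion F P W).

Lemma measurable_simple_val2 (H : @simple_process R d Omega) : simple_adapted F H ->
  measurable_fun setT (fun p : measurableTypeR R * Omega => simple_val H p.1 p.2).
Proof.
move=> [s0 s_mono mc _]; apply: measurable_sum => q; apply: measurable_funM.
  apply: (measurableT_comp (f := sp_coef H q)); last exact: measurable_snd.
  apply: (measurable_wrt_measurable F hF (sp_time H q)) => //.
  by elim: {mc} (nat_of_ord q) => [|r IH] //; exact: le_trans (s_mono r).
apply: (measurableT_comp (f := (\1_(`]sp_time H q, sp_time H q.+1]) : measurableTypeR R -> R))).
  exact: measurable_indic.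
exact: measurable_fst.
Qed.

(** Progressive measurability makes the integrand jointly measurable on [[0, t]], so Tonelli applies
    to its integral in time. *)
Lemma measurable_distance (H : @simple_process R d Omega) sigma (t : R) : 0 <= t ->
  simple_adapted F H -> progressive F sigma ->
  measurable_fun setT (fun w => \int[lebesgue_measure]_(u in `[0%R, t])
     ((simple_val H u w - sigma u w) ^+ 2)%:E)%E.
Proof.
move=> t0 aH ps.
pose D : set (measurableTypeR R * Omega) := `[0, t] `*` setT.
have mD : measurable D by exact: measurableX.
pose f (p : measurableTypeR R * Omega) : \bar R := ((simple_val H p.1 p.2 - sigma p.1 p.2) ^+ 2)%:E.
have mf : measurable_fun setT (f \_ D).
  apply/(measurable_restrictT _ mD)/measurable_EFinP; apply: measurable_funX; apply: measurable_funB.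
    by apply: measurable_funTS; exact: measurable_simple_val2.
  exact: (progressive_measurable F hF sigma t ps t0).
have f0 p : (0 <= (f \_ D) p)%E.
  by rewrite patchE; case: ifP => // _; rewrite lee_fin sqr_ge0.
have := measurable_fun_fubini_tonelli_G (m1 := lebesgue_measure) (f \_ D) mf f0.
congr (measurable_fun _ _); apply/funext => w; rewrite /fubini_G [RHS]integral_mkcond.
apply: eq_integral => u _; rewrite !patchE /D.
have [uI|uI] := boolP (u \in `[0, t]%classic).
  rewrite mem_set//; split => //; by move: uI; rewrite inE.
by rewrite memNset// => -[/=]; move: uI; rewrite notin_setE.
Qed.

Lemma simple_integral_path (H : @simple_process R d Omega) w (a : nat -> R) t :
  0 <= sp_time H 0 -> (forall q, sp_time H q <= sp_time H q.+1) ->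
  (forall n, 0 <= a n) -> a @ \oo --> t ->
  simple_integral W H (a n) w @[n --> \oo] --> simple_integral W H t w.
Proof.
move=> s0 s_mono a0 at_; rewrite /simple_integral.
have snn q : 0 <= sp_time H q by elim: q => [|q IH] //; exact: le_trans (s_mono q).
apply: cvg_sumr => q; apply: cvgM; first exact: cvg_cst.
have path i : W (Num.min (sp_time H i) (a n)) w @[n --> \oo] --> W (Num.min (sp_time H i) t) w.
  apply: (within_cvgn _ (fun t => W t w) (fun n => Num.min (sp_time H i) (a n))).
  - by case: hW => _ h _ _ _; exact: h.
  - by move=> n; rewrite le_min snn a0.
  - apply: (cvg_comp a (fun u => Num.min (sp_time H i) u) at_).
    by apply: (@continuous_min _ _ (cst (sp_time H i)) id); [exact: cst_continuous|exact: cvg_id].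
by apply: cvgB.
Qed.

Lemma measurable_simple_integral (H : @simple_process R d Omega) t : 0 <= t ->
  simple_adapted F H -> measurable_fun setT (simple_integral W H t).
Proof.
move=> t0 [s0 s_mono mc _].
have snn q : 0 <= sp_time H q by elim: q => [|q IH] //; exact: le_trans (s_mono q).
apply: measurable_sum => q; apply: measurable_funM.
  by apply: (measurable_wrt_measurable F hF (sp_time H q)).
by apply: (measurable_brownian_incr P F W hF hW); rewrite le_min snn.
Qed.

(* By path continuity the supremum may be taken over the countable set of the
   multiples [t * (i / n.+1)]. *)
Lemma sup_event_countable (f : R -> R) (t e : R) : 0 <= t ->
  (forall (a : nat -> R) b, (forall n, 0 <= a n) -> a @ \oo --> b -> f (a n) @[n --> \oo] --> f b) ->
  (e%:E <= ereal_sup [set (`|f u|)%:E | u in `[0%R, t]])%E <->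
  (forall k, exists n i, (i <= n.+1)%N /\ e - k.+1%:R^-1 < `|f (t * (i%:R / n.+1%:R))|).
Proof.
move=> t0 cf; split.
  move=> le k.
  have : ((e - k.+1%:R^-1)%:E < ereal_sup [set (`|f u|)%:E | u in `[0%R, t]])%E.
    by apply: lt_le_trans le; rewrite lte_fin gtrBl invr_gt0.
  move=> /ereal_sup_gt[_ [u /= uI <-]]; rewrite lte_fin => lt.
  move: uI; rewrite in_itv/= => /andP[u0 ut].
  have [tz|tnz] := eqVneq t 0.
    exists 0%N, 0%N; split => //; rewrite tz mul0r.
    by have -> : 0 = u by apply/eqP; rewrite eq_le u0 -tz ut.
  have tp : 0 < t by rewrite lt_neqAle eq_sym tnz.
  pose a n := t * ((Num.trunc (u / t * n.+1%:R))%:R / n.+1%:R).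
  have at_ : a @ \oo --> u.
    have : t * ((Num.trunc (u / t * n.+1%:R))%:R / n.+1%:R) @[n --> \oo] --> t * (u / t).
      by apply: cvgM; [exact: cvg_cst|apply: truncn_grid_cvg; rewrite divr_ge0].
    by rewrite [t * (u / t)]mulrC divfK.
  have a0 n : 0 <= a n by rewrite mulr_ge0// divr_ge0.
  have [n _ /(_ n (leqnn n)) /= h] := cvgr_gt _ (cvg_norm (cf a u a0 at_)) _ lt.
  exists n, (Num.trunc (u / t * n.+1%:R)); split => //.
  rewrite -(ler_nat R); apply: le_trans (_ : u / t * n.+1%:R <= _).
    by have /andP[] := truncn_itv (mulr_ge0 (divr_ge0 u0 t0) (ler0n R n.+1)).
  by rewrite ler_piMl// ler_pdivrMr// mul1r.
move=> H; apply/lee_addgt0Pr => eps eps0.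
have [k _ /(_ k (leqnn k)) /= hk] := near_infty_natSinv_lt (PosNum eps0).
have [n [i [ni h]]] := H k.
apply: (@le_trans _ _ ((`|f (t * (i%:R / n.+1%:R))|)%:E + eps%:E)%E).
  have hk' : k.+1%:R^-1 < eps := hk; rewrite -EFinD lee_fin -lerBlDr.
  by apply: le_trans (ltW h); rewrite lerD2l lerN2; exact: ltW.
apply: leeD2r; apply: ereal_sup_ubound; exists (t * (i%:R / n.+1%:R)) => //=.
rewrite in_itv/= mulr_ge0 ?divr_ge0//= ler_piMr// ler_pdivrMr// mul1r ler_nat //.
Qed.

Lemma measurable_sup_event (H : @simple_process R d Omega) (I : R -> Omega -> R) (t e : R) :
  0 <= t -> simple_adapted F H -> continuous_paths I ->
  (forall t : R, 0 <= t -> measurable_fun setT (I t : Omega -> measurableTypeR R)) ->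
  measurable [set w | (e%:E <= ereal_sup [set (`|simple_integral W H u w - I u w|)%:E | u in `[0%R, t]])%E].
Proof.
move=> t0 aH cI mI.
pose f w u := simple_integral W H u w - I u w.
rewrite (_ : [set w | _] = \bigcap_k \bigcup_n \bigcup_i
   [set w | (i <= n.+1)%N /\ e - k.+1%:R^-1 < `|f w (t * (i%:R / n.+1%:R))|]).
  apply: bigcapT_measurable => k; apply: bigcupT_measurable => n; apply: bigcupT_measurable => i.
  have [ni|ni] := leqP i n.+1; last first.
    by rewrite (_ : [set w | _] = set0)//; apply/seteqP; split => w //= -[].
  rewrite (_ : [set w | _] = [set w | e - k.+1%:R^-1 < `|f w (t * (i%:R / n.+1%:R))|]); last first.
    by apply/seteqP; split => w //= -[].
  apply: measurable_set_lt => //; apply: measurableT_comp => //; apply: measurable_funB.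
    by apply: measurable_simple_integral => //; rewrite mulr_ge0 ?divr_ge0.
  by apply: mI; rewrite mulr_ge0 ?divr_ge0.
have cf w : forall (a : nat -> R) b, (forall n, 0 <= a n) -> a @ \oo --> b ->
    f w (a n) @[n --> \oo] --> f w b.
  move=> a b a0 ab; case: (aH) => h1 h2 _ _; apply: cvgB; first exact: simple_integral_path.
  exact: (within_cvgn _ (fun t => I t w)).
apply/seteqP; split => w /=.
  move=> /(sup_event_countable (f w) t e t0 (cf w)) h k _.
  by have [n [i ni]] := h k; exists n => //; exists i.
move=> h; apply/(sup_event_countable (f w) t e t0 (cf w)) => k.
by have [n _ [i _ ni]] := h k Logic.I; exists n, i.
Qed.

End Events.

(** * From convergence in probability to almost sure convergence *)

Section GoodSequence.
Context {R : realType} {d : measure_display} {Omega : measurableType d}.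
Variables (P : probability Omega R) (F : R -> set (set Omega)) (W : R -> Omega -> R).
Hypotheses (hF : is_filtration F) (hW : brownian_motion F P W).

(** One sequence serves as step bound, as approximation error and as probability of failure: it is
    summable, as Borel-Cantelli asks, and at most 1, as the comparison of clocks asks. *)
Definition dyadic_tol (k : nat) : R := ((2 ^ k.+1)%:R)^-1.

Lemma dyadic_tol_gt0 k : 0 < dyadic_tol k.
Proof. by rewrite invr_gt0 ltr0n expn_gt0. Qed.

Lemma dyadic_tol_le1 k : dyadic_tol k <= 1.
Proof. by rewrite invf_le1 ?ler1n ?ltr0n expn_gt0. Qed.

Lemma dyadic_tol_cvg : dyadic_tol @ \oo --> 0.
Proof.
apply: (@squeeze_cvgr _ _ _ _ (cst 0) (fun k => k.+1%:R^-1)).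
- apply: nearW => k /=; rewrite ltW ?dyadic_tol_gt0//=.
  rewrite lef_pV2 ?posrE ?ltr0n ?expn_gt0// ler_nat ltnW//.
  by apply: leq_trans (ltn_expl k.+1 _).
- exact: cvg_cst.
- exact: cvg_harmonic.
Qed.

Lemma cvg_prob0_lt (E : nat -> set Omega) (e : R) : 0 < e ->
  (P (E n) @[n --> \oo] --> 0)%E -> \forall n \near \oo, (P (E n) < e%:E)%E.
Proof.
move=> e0 /fine_cvgP[fin cv].
apply: filterS2 fin (cvgr_lt _ cv _ e0) => n fn; rewrite -lte_fin => h.
by rewrite -(fineK fn).
Qed.

Lemma good_simple_process sigma I k : is_ito_integral F P W sigma I -> progressive F sigma ->
  exists H : @simple_process R d Omega, [/\ simple_adapted F H,
    forall q w, sp_coef H q w ^+ 2 * (sp_time H q.+1 - sp_time H q) <= dyadic_tol k,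
    (P [set w | (((dyadic_tol k) ^+ 2)%:E <= \int[lebesgue_measure]_(u in `[0%R, k%:R])
             ((simple_val H u w - sigma u w) ^+ 2)%:E)%E] <= (dyadic_tol k)%:E)%E
   & (P [set w | ((dyadic_tol k)%:E <= ereal_sup
             [set (`|simple_integral W H u w - I u w|)%:E | u in `[0%R, k%:R]])%E] <= (dyadic_tol k)%:E)%E].
Proof.
move=> [mI cI [H [aH approx]]] ps.
have k0 : (0 : R) <= k%:R by [].
have e0 := dyadic_tol_gt0 k.
have [c1 c2] := approx k%:R k0.
have n1 := cvg_prob0_lt _ _ e0 (c1 _ (exprn_gt0 2 e0)).
have n2 := cvg_prob0_lt _ _ e0 (c2 _ e0).
have [n [/ltW h1 /ltW h2]] := filter_ex (filterI n1 n2).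
have [H' [aH' bH' vE iE]] := simple_process_refine F hF W (H n) _ (aH n) e0.
by exists H'; split => //; rewrite ?vE ?iE.
Qed.

(** Borel-Cantelli along a subsequence. The horizon [k] grows with the index, so every compact time
    interval is eventually covered. *)
Lemma good_sequence sigma I : is_ito_integral F P W sigma I -> progressive F sigma ->
  exists H : nat -> @simple_process R d Omega, [/\ forall k, simple_adapted F (H k),
    forall k q w, sp_coef (H k) q w ^+ 2 * (sp_time (H k) q.+1 - sp_time (H k) q) <= dyadic_tol k
    & {ae P, forall w, \forall k \near \oo,
       (\int[lebesgue_measure]_(u in `[0%R, k%:R])
             ((simple_val (H k) u w - sigma u w) ^+ 2)%:E <= ((dyadic_tol k) ^+ 2)%:E)%E /\
       forall u, 0 <= u <= k%:R -> `|simple_integral W (H k) u w - I u w| <= dyadic_tol k}].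
Proof.
move=> hI ps.
have /choice[H HP] := fun k => good_simple_process sigma I k hI ps.
have aH k : simple_adapted F (H k) by have [] := HP k.
exists H; split => //.
- by move=> k; have [_ h1 _ _] := HP k.
pose E1 k := [set w | (((dyadic_tol k) ^+ 2)%:E <= \int[lebesgue_measure]_(u in `[0%R, k%:R])
             ((simple_val (H k) u w - sigma u w) ^+ 2)%:E)%E].
pose E2 k := [set w | ((dyadic_tol k)%:E <= ereal_sup
             [set (`|simple_integral W (H k) u w - I u w|)%:E | u in `[0%R, k%:R]])%E].
have k0 k : (0 : R) <= k%:R by [].
have mE1 k : measurable (E1 k).
  rewrite /E1 -[X in measurable X]setTI; apply: emeasurable_fun_c_infty => //.
  exact: (measurable_distance F).
have mE2 k : measurable (E2 k).
  by case: hI => mI cI _; apply: (measurable_sup_event P F W hF hW).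
have mE k : measurable (E1 k `|` E2 k) by exact: measurableU.
have sumE : (\sum_(k <oo) P (E1 k `|` E2 k) < +oo)%E.
  (* The two bad events of index [k] have together probability at most [2 / 2^(k+1)], and these
     bounds sum to 2. *)
  apply: (@le_lt_trans _ _ 2%:E); last exact: ltry.
  apply: (le_trans _ (@epsilon_trick0 R 2 xpredT _)) => //.
  apply: lee_nneseries => // k _.
  apply: (le_trans (measureU2 P (mE1 k) (mE2 k))).
  have [_ _ h1 h2] := HP k; apply: (le_trans (leeD h1 h2)).
  by rewrite -EFinD lee_fin -mulr2n mulr_natl.
exists (lim_sup_set (fun k => E1 k `|` E2 k)); split.
- by apply: bigcap_measurable => // k _; apply: bigcup_measurable.
- exact: lim_sup_set_cvg0.
move=> w /= nw; apply: contrapT => nlim; apply: nw.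
have [N hN] : exists N, forall k, (N <= k)%N -> ~ (E1 k `|` E2 k) w.
  apply: contrapT => /forallNP h; apply: nlim => n _.
  have [k nk] : exists k, ~ ((n <= k)%N -> ~ (E1 k `|` E2 k) w).
    by apply: contrapT => /forallNP h'; apply: (h n) => k; exact: contrapT (h' k).
  by move: nk => /not_implyP[nk' /contrapT Ek]; exists k.
exists N => // k /= /hN /not_orP[n1 n2]; split.
  by apply: ltW; rewrite ltNge; apply/negP.
move=> u uk; rewrite -lee_fin; apply: ltW.
have : (ereal_sup [set (`|simple_integral W (H k) u w - I u w|)%:E | u in `[0%R, k%:R]] < (dyadic_tol k)%:E)%E.
  by rewrite ltNge; apply/negP.
apply: le_lt_trans; apply: ereal_sup_ubound; exists u => //=.
Qed.

End GoodSequence.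

(** * The time-changed stochastic integral *)

Section TimeChange.
Context {R : realType} {d : measure_display} {Omega : measurableType d}.
Variables (P : probability Omega R) (F : R -> set (set Omega)) (W : R -> Omega -> R).
Hypotheses (hF : is_filtration F) (hW : brownian_motion F P W).
Variables (sigma I T : R -> Omega -> R).
Hypotheses (psigma : progressive F sigma) (hI : is_ito_integral F P W sigma I).
Hypothesis hT : inverse_time_change P (clock sigma) T.
Hypothesis sigma_fin : {ae P, forall w, forall t : R, 0 <= t ->
  (\int[lebesgue_measure]_(u in `[0%R, t]) (sigma u w ^+ 2)%:E < +oo)%E}.

(** The almost sure properties of a path from which, with [T] nonnegative, the deterministic results
    on inverse clocks follow. *)
Definition clock_path (w : Omega) : Prop :=
  [/\ forall t : R, 0 <= t -> lebesgue_measure.-integrable `[0, t] (EFin \o (fun u => sigma u w ^+ 2)),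
    forall r t : R, 0 <= r -> r <= t -> T r w <= T t w
    & forall t : R, 0 <= t -> T (clock sigma t w) w = t].

Lemma ae_clock_path : {ae P, forall w, clock_path w}.
Proof.
case: hT => _ _ Tm TA.
apply: filterS3 sigma_fin Tm TA => w fin Tm' TA'; split => // t t0.
apply/integrableP; split.
  by apply/measurable_EFinP; apply: measurable_funX; exact: (progressive_section F hF).
under eq_integral do rewrite /= ger0_norm ?sqr_ge0//.
exact: fin.
Qed.

Section FixedPath.
Variable (w : Omega).
Hypothesis hw : clock_path w.

Let intf : forall t, 0 <= t -> lebesgue_measure.-integrable `[0, t] (EFin \o (fun u => sigma u w ^+ 2)).
Proof. by case: hw. Qed.

Lemma clock_path0 : clock sigma 0 w = 0.
Proof. by rewrite /clock set_itv1 Rintegral_set1. Qed.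

Lemma clock_path_mono r t : 0 <= r -> r <= t -> clock sigma r w <= clock sigma t w.
Proof. by move=> r0 rt; apply: Rintegral_nonneg_mono => // u _; exact: sqr_ge0. Qed.

Lemma clock_path_continuous : {within `[0, +oo[, continuous (fun t => clock sigma t w)}.
Proof. exact: Rintegral_continuous_halfline. Qed.

Lemma time_ge0 t : 0 <= t -> 0 <= T t w.
Proof. by case: hT => _ + _ _ t0; apply. Qed.

Lemma time_path_mono r t : 0 <= r -> r <= t -> T r w <= T t w.
Proof. by case: hw => _ + _; apply. Qed.

Lemma time_pathK t : 0 <= t -> T (clock sigma t w) w = t.
Proof. by case: hw => _ _; apply. Qed.

Lemma clock_pathK t : 0 <= t -> clock sigma (T t w) w = t.
Proof.
exact: (clockK (fun t => clock sigma t w) (fun t => T t w) clock_path0 clock_path_mono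
  clock_path_continuous time_ge0 time_path_mono time_pathK).
Qed.

Lemma time_path_cvg (a : nat -> R) b : (forall n, 0 <= a n) ->
  a @ \oo --> b -> T (a n) w @[n --> \oo] --> T b w.
Proof.
exact: (inverse_clock_continuous (fun t => clock sigma t w) (fun t => T t w) clock_path0 clock_path_mono
  clock_path_continuous time_ge0 time_path_mono time_pathK).
Qed.

Lemma clock_path_unbounded t : 0 <= t -> exists2 r, 0 <= r & t <= clock sigma r w.
Proof.
exact: (clock_unbounded (fun t => clock sigma t w) (fun t => T t w) clock_path0 clock_path_mono
  time_ge0 time_path_mono time_pathK).
Qed.

Lemma clock_path_inv_cvg (u : nat -> R) b : (forall n, 0 <= u n) ->
  clock sigma (u n) w @[n --> \oo] --> b -> u @ \oo --> T b w.
Proof.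
exact: (inverse_clock_cvg (fun t => clock sigma t w) (fun t => T t w) clock_path0 clock_path_mono
  clock_path_continuous time_ge0 time_path_mono time_pathK).
Qed.

End FixedPath.

(* The Dambis-Dubins-Schwarz Brownian motion of the local martingale [I]. *)
Definition dds (t : R) (w : Omega) : R := I (T t w) w.

Lemma measurable_dds t : 0 <= t -> measurable_fun setT (dds t).
Proof.
move=> t0; case: hT => mT T0 _ _; case: hI => mI cI _.
apply: (measurable_fun_time_subst _ _ _ I (T t)) => //.
- exact: mT.
- by move=> w; exact: T0.
- by move=> w a a0 at_; apply: (within_cvgn _ (fun t => I t w)).
Qed.

Lemma dds_path_cvg w (a : nat -> R) b : clock_path w -> (forall n, 0 <= a n) ->
  a @ \oo --> b -> dds (a n) w @[n --> \oo] --> dds b w.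
Proof.
move=> hw a0 ab; case: hI => _ cI _.
apply: (within_cvgn _ (fun t => I t w) (fun n => T (a n) w)) => //.
  by move=> n; exact: time_ge0.
exact: time_path_cvg.
Qed.

Section Approximation.
Variable (H : nat -> @simple_process R d Omega).
Hypotheses (aH : forall k, simple_adapted F (H k))
  (bH : forall k q w, sp_coef (H k) q w ^+ 2 * (sp_time (H k) q.+1 - sp_time (H k) q) <= dyadic_tol k).

(** The indicator of a phase is a difference of two threshold indicators, the form in which the
    pathwise limit is available. *)
Lemma phase_difference k j (f : nat -> R) w delta : 0 <= delta ->
  \sum_(p < sp_size (H k)) (in_phase (sp_time (H k)) (sp_coef (H k)) delta j p w)%:R * f p =
  \sum_(p < sp_size (H k)) (\sum_(r < p.+1) step_var (sp_time (H k)) (sp_coef (H k)) r w <= j.+1%:R * delta)%R%:R * f p -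
  \sum_(p < sp_size (H k)) (\sum_(r < p.+1) step_var (sp_time (H k)) (sp_coef (H k)) r w <= j%:R * delta)%R%:R * f p.
Proof.
move=> delta0; rewrite -sumrB; apply: eq_bigr => p _; rewrite -mulrBl; congr (_ * _).
have jj : j%:R * delta <= j.+1%:R * delta by rewrite ler_wpM2r// ler_nat.
rewrite /in_phase /step_clock; set a := \sum_(r < _) _.
case: (ltP (j%:R * delta) a) => h1; case: (leP a (j.+1%:R * delta)) => h2 /=; rewrite ?subr0 ?subrr//.
by have := lt_le_trans h2 (le_trans h1 jj); rewrite ltxx.
Qed.

Lemma phase_cvg w j delta : 0 <= delta -> clock_path w ->
  (\forall k \near \oo,
       (\int[lebesgue_measure]_(u in `[0%R, k%:R])
             ((simple_val (H k) u w - sigma u w) ^+ 2)%:E <= ((dyadic_tol k) ^+ 2)%:E)%E /\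
       forall u, 0 <= u <= k%:R -> `|simple_integral W (H k) u w - I u w| <= dyadic_tol k) ->
  phase_walk W (sp_time (H k)) (sp_coef (H k)) delta j (sp_size (H k)) w @[k --> \oo] -->
    dds (j.+1%:R * delta) w - dds (j%:R * delta) w /\
  phase_var (sp_time (H k)) (sp_coef (H k)) delta j (sp_size (H k)) w @[k --> \oo] --> delta.
Proof.
move=> delta0 hw good.
pose s k := sp_time (H k).
pose v k p := step_var (sp_time (H k)) (sp_coef (H k)) p w.
pose x k p := sp_coef (H k) p w * (W (s k p.+1) w - W (s k p) w).
have s_mono k p : s k p <= s k p.+1 by have [_ h _ _] := aH k; exact: h.
have s0 k p : 0 <= s k p by elim: p => [|p IH]; [by have [h _ _ _] := aH k|exact: le_trans (s_mono k p)].
have lim tau : 0 <= tau ->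
  \sum_(p < sp_size (H k)) (\sum_(r < p.+1) v k r <= tau)%R%:R * x k p @[k --> \oo] --> I (T tau w) w /\
  \sum_(p < sp_size (H k)) (\sum_(r < p.+1) v k r <= tau)%R%:R * v k p @[k --> \oo] --> tau.
  apply: (path_limit s v x (fun k => sp_size (H k)) (fun k t => simple_clock (H k) t w)
    (fun k t => simple_integral W (H k) t w) dyadic_tol (fun t => clock sigma t w)
    (fun t => I t w) (fun t => T t w)) => //.
  - by move=> k p; apply: step_var_ge0; exact: s_mono.
  - by move=> k p; exact: bH.
  - by move=> k; exact/ltW/dyadic_tol_gt0.
  - exact: dyadic_tol_cvg.
  - by move=> k q qN; exact: (simple_clock_grid _ (s_mono k)).
  - by move=> k r t _ rt; exact: (simple_clock_mono _ (s_mono k)).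
  - by move=> k t; exact: (simple_clock_total _ (s_mono k)).
  - by move=> k q qN; exact: (simple_integral_grid _ (s_mono k)).
  - exact: clock_path_unbounded.
  - exact: clock_path_inv_cvg.
  - by case: hI.
  - apply: filterS good => k [h1 h2] t tk; have /andP[t0 tK] := tk.
    have k0 : (0 : R) <= k%:R by [].
    have sfin : (\int[lebesgue_measure]_(u in `[0%R, k%:R]) (sigma u w ^+ 2)%:E < +oo)%E.
      have [intw _ _] := hw; have /integrableP[_] := intw _ k0.
      by under eq_integral do rewrite /= ger0_norm ?sqr_ge0//.
    have [c1 c2] := simple_clock_compare (H k) (s0 k 0%N) (s_mono k) (fun u => sigma u w)
      k%:R t _ w t0 tK (dyadic_tol_gt0 k) (dyadic_tol_le1 k)
      (progressive_section F hF sigma _ w psigma k0) sfin h1.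
    by split; [exact: h2|exact: c1|exact: c2].
have j0 i : 0 <= i%:R * delta by rewrite mulr_ge0.
have [w1 v1] := lim _ (j0 j.+1); have [w2 v2] := lim _ (j0 j).
split.
  apply: cvg_trans (cvgB w1 w2); apply: near_eq_cvg; apply: nearW => k.
  rewrite /phase_walk; under [RHS]eq_bigr do rewrite -mulrA.
  by rewrite [RHS](phase_difference k j (x k)).
have dE : j.+1%:R * delta - j%:R * delta = delta by rewrite -natr1; ring.
rewrite -[X in _ --> X]dE; apply: cvg_trans (cvgB v1 v2); apply: near_eq_cvg; apply: nearW => k.
by rewrite /phase_var [RHS](phase_difference k j (v k)).
Qed.

End Approximation.

(** The expectation of the final [walk_value] is passed to the limit in two ways. Pathwise, the
    budgets are used up and the walks tend to the increments of [dds]; on the other side, the exact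
    value for each [k] is a product of heat terms at time [delta + dyadic_tol k]. *)
Lemma expectation_dds_increments n (g : 'I_n -> R -> R) (delta : R) : 0 <= delta ->
  (forall j, unit_continuous (g j)) ->
  (\int[P]_w (\prod_j g j (dds (j.+1%:R * delta) w - dds (j%:R * delta) w))%:E =
   (\prod_j heat P W (g j) delta 0)%:E)%E.
Proof.
move=> delta0 hg.
have [H [aH bH good]] := good_sequence P F W hF hW sigma I hI psigma.
have s_mono k p : sp_time (H k) p <= sp_time (H k) p.+1 by have [_ h _ _] := aH k; exact: h.
have s0 k : 0 <= sp_time (H k) 0 by have [h _ _ _] := aH k.
have mc k q : measurable_wrt (F (sp_time (H k) q)) (sp_coef (H k) q) by have [_ _ h _] := aH k; exact: h.
have e0 k := ltW (@dyadic_tol_gt0 R k).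
pose V k w := walk_value P W (sp_time (H k)) (sp_coef (H k)) (dyadic_tol k) delta n g (sp_size (H k)) w.
have mB j : measurable_fun setT (dds (j%:R * delta)) by apply: measurable_dds; rewrite mulr_ge0.
have lim1 : (\int[P]_w (V k w)%:E @[k --> \oo] -->
    \int[P]_w (\prod_j g j (dds (j.+1%:R * delta) w - dds (j%:R * delta) w))%:E)%E.
  apply: bounded_expectation_cvg.
  - move=> k; exact: (measurable_walk_value P F W hF hW _ _ _ _ (s0 k) (s_mono k) (mc k)
      (e0 k) delta0 (bH k) n g hg).
  - apply: measurable_prod => j _; have [cg _] := hg j.
    apply: (measurableT_comp (f := g j) (g := fun w => dds (j.+1%:R * delta) w - dds (j%:R * delta) w)).
      exact: continuous_measurable_fun.
    exact: measurable_funB.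
  - by move=> k w; exact: (walk_value01 P F W hF hW _ _ _ _ (s_mono k) (e0 k) delta0 (bH k) n g hg).
  - apply: filterS2 ae_clock_path good => w hw gw; apply: cvg_prodr => j.
    have [c1 c2] := phase_cvg H aH bH w j delta delta0 hw gw.
    have [cg g01] := hg j.
    (* Writing [g j] as the heat semigroup at time 0 lets the joint continuity of [heat] treat the
       vanishing budget and the converging walk at once. *)
    rewrite -(heat0 P W (g j)); apply: (heat_cvg P F W hF hW) => //.
      by move=> k; exact: (phase_budget_ge0 _ _ _ _ (s_mono k) (e0 k) delta0 (bH k)).
    have -> : (0 : R) = delta + 0 - delta by rewrite addr0 subrr.
    apply: cvgB => //; apply: cvgD; [exact: cvg_cst|exact: dyadic_tol_cvg].
have lim2 : (\int[P]_w (V k w)%:E @[k --> \oo] --> (\prod_j heat P W (g j) delta 0)%:E)%E.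
  have : (\prod_j heat P W (g j) (delta + dyadic_tol k) 0)%:E @[k --> \oo] --> (\prod_j heat P W (g j) delta 0)%:E.
    apply: cvg_EFin; first exact: nearW.
    apply: cvg_prodr => j; have [cg g01] := hg j.
    apply: (heat_cvg P F W hF hW) => //; last exact: cvg_cst.
      by move=> k; rewrite addr_ge0.
    by rewrite -[X in _ --> X]addr0; apply: cvgD; [exact: cvg_cst|exact: dyadic_tol_cvg].
  apply: cvg_trans; apply: near_eq_cvg; apply: nearW => k.
  by rewrite /V (expectation_walk_value P F W hF hW _ _ _ _ (s0 k) (s_mono k) (mc k) (e0 k) delta0 (bH k) n g hg).
by move: lim1 => /cvg_lim <- //; move: lim2 => /cvg_lim <-.
Qed.

End TimeChange.

(** * Drawdowns *)

(** Extending [f] to negative arguments by its value at 0 reduces the claim to sequential continuity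
    on the whole line. *)
Lemma cvgn_within_continuous (R : realType) (f : R -> R) :
  (forall (u : nat -> R) x, (forall n, 0 <= u n) -> u @ \oo --> x -> f (u n) @[n --> \oo] --> f x) ->
  {within `[0, +oo[, continuous f}.
Proof.
move=> H.
have cmax : continuous (fun x : R => Num.max 0 x).
  by move=> x; apply: (@continuous_max _ _ (cst 0) id); [exact: cst_continuous|exact: cvg_id].
have cf : continuous (fun x : R => f (Num.max 0 x)).
  move=> x; apply: cvgn_continuous => u ux; apply: (H (fun n => Num.max 0 (u n))).
    by move=> n; rewrite le_max lexx.
  exact: (cvg_comp u (fun x => Num.max 0 x) ux (cmax x)).
apply: (@subspace_eq_continuous _ _ _ (fun x : R => f (Num.max 0 x))).
  by move=> x; rewrite inE/= in_itv/= andbT => x0; rewrite max_r.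
exact: continuous_subspaceT.
Qed.

Fixpoint prefix_max {R : realType} (f : nat -> R) (r : nat) : R :=
  if r is r'.+1 then Num.max (prefix_max f r') (f r) else f 0%N.

Lemma prefix_max_le {R : realType} (f : nat -> R) r M :
  (forall p, (p <= r)%N -> f p <= M) -> prefix_max f r <= M.
Proof.
elim: r => [|r IH] H /=; first exact: H.
by rewrite ge_max H// IH// => p pr; apply: H; exact: leqW.
Qed.

Lemma le_prefix_max {R : realType} (f : nat -> R) r p : (p <= r)%N -> f p <= prefix_max f r.
Proof.
elim: r => [|r IH]; first by rewrite leqn0 => /eqP ->.
rewrite leq_eqVlt => /orP[/eqP ->|]; first by rewrite /= le_max lexx orbT.
by rewrite ltnS => /IH h /=; rewrite le_max h.
Qed.

Lemma eq_prefix_max {R : realType} (f g : nat -> R) r :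
  (forall p, (p <= r)%N -> f p = g p) -> prefix_max f r = prefix_max g r.
Proof.
elim: r => [|r IH] H /=; first exact: H.
by rewrite H// IH// => p pr; apply: H; exact: leqW.
Qed.

Section GridSup.
Context {R : realType}.
Variable (z : R -> R).
Hypothesis cz : forall (u : nat -> R) x, (forall n, 0 <= u n) ->
  u @ \oo --> x -> z (u n) @[n --> \oo] --> z x.

Lemma path_sup_attained t : 0 <= t ->
  exists2 c, 0 <= c <= t & (forall u, 0 <= u <= t -> z u <= z c) /\ sup [set z u | u in `[0, t]] = z c.
Proof.
move=> t0.
have cw : {within `[0, t], continuous z}.
  apply: continuous_subspaceW (cvgn_within_continuous _ z cz) => x /=.
  by rewrite !in_itv/= andbT => /andP[].
have [c cI cmax] := EVT_max t0 cw.
exists c; first by move: cI; rewrite in_itv.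
have cm u : 0 <= u <= t -> z u <= z c by move=> h; apply: cmax; rewrite in_itv.
split => //; apply/eqP; rewrite eq_le; apply/andP; split.
  apply: ge_sup; first by exists (z c), c.
  by move=> _ [u /= uI <-]; exact: cmax.
apply: ub_le_sup; last by exists c.
by exists (z c) => _ [u /= uI <-]; exact: cmax.
Qed.

(** The discrete maximum lies between the supremum and the value at the grid point just below a
    maximiser. *)
Lemma prefix_max_cvg t : 0 <= t ->
  prefix_max (fun r => z (r%:R / k.+1%:R)) (Num.trunc (t * k.+1%:R)) @[k --> \oo] -->
  sup [set z u | u in `[0, t]].
Proof.
move=> t0; have [c /andP[c0 ct] [cmax ->]] := path_sup_attained t t0.
apply: (@squeeze_cvgr _ _ _ _
  (fun k => z ((Num.trunc (c * k.+1%:R))%:R / k.+1%:R)) (cst (z c))).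
- apply: nearW => k; apply/andP; split.
    apply: (le_prefix_max (fun r => z (r%:R / k.+1%:R))).
    by apply: le_truncn; rewrite ler_wpM2r.
  apply: prefix_max_le => p pk; apply: cmax; rewrite divr_ge0//= ler_pdivrMr//.
  apply: le_trans (_ : (Num.trunc (t * k.+1%:R))%:R <= _); first by rewrite ler_nat.
  by have /andP[] := truncn_itv (mulr_ge0 t0 (ler0n R k.+1)).
- by apply: cz; [move=> k; rewrite divr_ge0|exact: truncn_grid_cvg].
- exact: cvg_cst.
Qed.

End GridSup.

(** * The law of the drawdown as a limit of functionals of grid increments *)

Section DrawdownLaw.
Context {R : realType}.
Variables (x c alpha : R) (n : nat) (t : n.-tuple R).
Hypothesis t0 : forall i, 0 <= tnth t i.

Definition grid_index k (i : 'I_n) : nat := Num.trunc (tnth t i * k.+1%:R).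

Definition grid_size k : nat := \max_(i < n) grid_index k i.

Lemma grid_index_le k i : (grid_index k i <= grid_size k)%N.
Proof. exact: leq_bigmax. Qed.

Definition grid_position k (y : (grid_size k).-tuple (measurableTypeR R)) (r : nat) : R :=
  x + c * (r%:R / k.+1%:R) + \sum_(l < grid_size k) (l < r)%N%:R * tnth y l.

(** A measurable function of the increments alone, with one grid for all observation times: equality
    of the joint laws of increments passes through it. *)
Definition grid_drawdown k (y : (grid_size k).-tuple (measurableTypeR R)) :
    n.-tuple (measurableTypeR R) :=
  [tuple grid_position k y (grid_index k i) -
    alpha * prefix_max (grid_position k y) (grid_index k i) | i < n].

Lemma measurable_grid_position k r : measurable_fun setT (fun y => grid_position k y r).
Proof.
apply: measurable_funD; first exact: measurable_cst.
apply: measurable_sum => l; apply: measurable_funM; first exact: measurable_cst.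
exact: measurable_tnth.
Qed.

Lemma measurable_grid_drawdown k : measurable_fun setT (grid_drawdown k).
Proof.
apply/measurable_fun_tnthP => i.
rewrite (_ : _ \o _ = fun y => grid_position k y (grid_index k i) -
    alpha * prefix_max (grid_position k y) (grid_index k i)); last first.
  by apply/funext => y /=; rewrite tnth_mktuple.
apply: measurable_funB; first exact: measurable_grid_position.
apply: measurable_funM; first exact: measurable_cst.
elim: (grid_index k i) => [|r IH] /=; first exact: measurable_grid_position.
by apply: measurable_maxr => //; exact: measurable_grid_position.
Qed.

Context {d : measure_display} {Omega : measurableType d} (P : probability Omega R).
Variable (b : R -> Omega -> R).
Hypotheses (mb : forall s, 0 <= s -> measurable_fun setT (b s))
  (b0 : {ae P, forall w, b 0 w = 0})
  (cb : {ae P, forall w, forall (u : nat -> R) s, (forall n, 0 <= u n) ->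
     u @ \oo --> s -> b (u n) w @[n --> \oo] --> b s w}).

(** The times are written as multiples of [k.+1%:R^-1] to match the phases of length [delta] at
    which the law of the increments is known. *)
Definition grid_increments k (w : Omega) : (grid_size k).-tuple (measurableTypeR R) :=
  [tuple b (l.+1%:R * k.+1%:R^-1) w - b (l%:R * k.+1%:R^-1) w | l < grid_size k].

Lemma measurable_grid_increments k : measurable_fun setT (grid_increments k).
Proof.
apply/measurable_fun_tnthP => l.
rewrite (_ : _ \o _ = fun w => b (l.+1%:R * k.+1%:R^-1) w - b (l%:R * k.+1%:R^-1) w); last first.
  by apply/funext => w /=; rewrite tnth_mktuple.
by apply: measurable_funB; apply: mb.
Qed.

Lemma grid_position_increments k w r : b 0 w = 0 -> (r <= grid_size k)%N ->
  grid_position k (grid_increments k w) r = x + c * (r%:R / k.+1%:R) + b (r%:R / k.+1%:R) w.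
Proof.
move=> bw rk; congr (_ + _).
pose f (l : nat) := b (l.+1%:R * k.+1%:R^-1) w - b (l%:R * k.+1%:R^-1) w.
transitivity (\sum_(l < grid_size k) (l < r)%N%:R * f l).
  by apply: eq_bigr => l _; rewrite tnth_mktuple.
rewrite (sum_threshold f (fun l => (l < r)%N) r)// {rk} /f.
elim: r => [|r IH]; first by rewrite big_ord0 mul0r bw.
by rewrite big_ord_recr/= IH addrC subrK.
Qed.

Definition drift_position (w : Omega) (s : R) : R := x + c * s + b s w.

Lemma drift_position_cvg w : (forall (u : nat -> R) s, (forall n, 0 <= u n) ->
     u @ \oo --> s -> b (u n) w @[n --> \oo] --> b s w) ->
  forall (u : nat -> R) s, (forall n, 0 <= u n) -> u @ \oo --> s ->
  drift_position w (u n) @[n --> \oo] --> drift_position w s.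
Proof.
move=> h u s u0 us; apply: cvgD; last exact: h.
by apply: cvgD; [exact: cvg_cst|apply: cvgM => //; exact: cvg_cst].
Qed.

Definition drift_drawdown (w : Omega) (s : R) : R :=
  drift_position w s - alpha * sup [set drift_position w u | u in `[0, s]].

Lemma grid_drawdown_cvg w i : b 0 w = 0 -> (forall (u : nat -> R) s, (forall n, 0 <= u n) ->
     u @ \oo --> s -> b (u n) w @[n --> \oo] --> b s w) ->
  tnth (grid_drawdown k (grid_increments k w)) i @[k --> \oo] --> drift_drawdown w (tnth t i).
Proof.
move=> bw cw; have cz := drift_position_cvg w cw.
have : drift_position w ((grid_index k i)%:R / k.+1%:R) -
    alpha * prefix_max (fun r => drift_position w (r%:R / k.+1%:R)) (grid_index k i) @[k --> \oo] -->
    drift_drawdown w (tnth t i).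
  apply: cvgB.
    by apply: (cz (fun k => (grid_index k i)%:R / k.+1%:R)); [move=> k; rewrite divr_ge0|exact: truncn_grid_cvg].
  by apply: cvgM; [exact: cvg_cst|exact: prefix_max_cvg].
apply: cvg_trans; apply: near_eq_cvg; apply: nearW => k.
rewrite tnth_mktuple grid_position_increments//; last exact: grid_index_le.
congr (_ - _ * _); apply: eq_prefix_max => p pi.
by rewrite grid_position_increments//; apply: leq_trans pi (grid_index_le k i).
Qed.

(** The drawdown contains a supremum over an uncountable set, and the paths of [b] are continuous
    only almost surely. Setting it to 0 on a null set makes it a pointwise limit of grid drawdowns,
    hence measurable. *)
Lemma drift_drawdown_version : exists Y : Omega -> n.-tuple (measurableTypeR R),
  [/\ measurable_fun setT Y, {ae P, forall w, forall i, tnth (Y w) i = drift_drawdown w (tnth t i)}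
    & forall g : 'I_n -> R -> R, (forall i, unit_continuous (g i)) ->
      (\int[P]_w (\prod_i g i (tnth (grid_drawdown k (grid_increments k w)) i))%:E @[k --> \oo] -->
       \int[P]_w (\prod_i g i (tnth (Y w) i))%:E)%E].
Proof.
have [N [mN N0 sN]] := filterI b0 cb.
pose Y w : n.-tuple (measurableTypeR R) := [tuple \1_(~` N) w * drift_drawdown w (tnth t i) | i < n].
have YE w i : tnth (Y w) i = \1_(~` N) w * drift_drawdown w (tnth t i) by rewrite tnth_mktuple.
have good w : ~ N w -> b 0 w = 0 /\ (forall (u : nat -> R) s, (forall n, 0 <= u n) ->
     u @ \oo --> s -> b (u n) w @[n --> \oo] --> b s w).
  by move=> Nw; apply: contrapT => h; apply/Nw/sN.
have mG k i : measurable_fun setT (fun w => tnth (grid_drawdown k (grid_increments k w)) i : R).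
  apply: (measurableT_comp (f := fun y => tnth (grid_drawdown k y) i)); last exact: measurable_grid_increments.
  by have /measurable_fun_tnthP := measurable_grid_drawdown k; exact.
have mY : measurable_fun setT Y.
  apply/measurable_fun_tnthP => i.
  rewrite (_ : _ \o _ = fun w => \1_(~` N) w * drift_drawdown w (tnth t i)); last first.
    by apply/funext => w /=; rewrite YE.
  apply: (@measurable_fun_cvg _ _ _ _
    (fun k w => \1_(~` N) w * tnth (grid_drawdown k (grid_increments k w)) i)).
    by move=> k; apply: measurable_funM => //; apply: measurable_indic; exact: measurableC.
  move=> w _; have [Nw|Nw] := pselect (N w).
    have i0 : \1_(~` N) w = 0 :> R by rewrite indicE memNset//=; apply.
    by rewrite i0 mul0r; under eq_fun do rewrite mul0r; exact: cvg_cst.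
  have [bw cw] := good w Nw.
  by apply: cvgM; [exact: cvg_cst|exact: grid_drawdown_cvg].
exists Y; split => //.
  exists N; split => // w; apply: contra_notP => Nw i.
  by rewrite YE indicE mem_set ?mul1r.
move=> g hg; apply: bounded_expectation_cvg.
- move=> k; apply: measurable_prod => i _; have [cg _] := hg i.
  by apply: (measurableT_comp (f := g i)); [exact: continuous_measurable_fun|exact: mG].
- apply: measurable_prod => i _; have [cg _] := hg i.
  apply: (measurableT_comp (f := g i) (g := fun w => tnth (Y w) i)); first exact: continuous_measurable_fun.
  by move/measurable_fun_tnthP: mY; exact.
- move=> k w; apply/andP; split.
    by apply: prodr_ge0 => i _; have [_ /(_ (tnth (grid_drawdown k (grid_increments k w)) i))/andP[]] := hg i.
  by apply: prodr_ile1 => i _; have [_] := hg i.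
- exists N; split => // w; apply: contra_notP => Nw; have [bw cw] := good w Nw.
  apply: cvg_prodr => i; have [cg _] := hg i; rewrite YE indicE mem_set// mul1r.
  exact: (cvg_comp (fun k => tnth (grid_drawdown k (grid_increments k w)) i) (g i)
    (grid_drawdown_cvg w i bw cw) (cg _)).
Qed.

End DrawdownLaw.

Section LawComparison.
Context {R : realType}.

Lemma integral_same_law d1 (T1 : measurableType d1) (P1 : probability T1 R)
    d2 (T2 : measurableType d2) (P2 : probability T2 R) d (T : measurableType d)
    (Y1 : T1 -> T) (Y2 : T2 -> T) (h : T -> \bar R) :
  measurable_fun setT Y1 -> measurable_fun setT Y2 ->
  (forall S, measurable S -> P1 (Y1 @^-1` S) = P2 (Y2 @^-1` S)) ->
  measurable_fun setT h -> (forall y, 0 <= h y)%E ->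
  (\int[P1]_w h (Y1 w) = \int[P2]_w h (Y2 w))%E.
Proof.
move=> mY1 mY2 law mh h0.
pose Z1 : {mfun T1 >-> T} := HB.pack Y1 (isMeasurableFun.Build _ _ _ _ _ mY1).
pose Z2 : {mfun T2 >-> T} := HB.pack Y2 (isMeasurableFun.Build _ _ _ _ _ mY2).
transitivity (\int[distribution P1 Z1]_y h y)%E; first by rewrite ge0_integral_distribution.
transitivity (\int[distribution P2 Z2]_y h y)%E; last by rewrite ge0_integral_distribution.
by apply: eq_measure_integral => A mA _; exact: law.
Qed.

Context {d : measure_display} {Omega : measurableType d} (P : probability Omega R).
Variables (b1 b2 : R -> Omega -> R) (x c alpha : R) (n : nat) (t : n.-tuple R).
Hypothesis t0 : forall i, 0 <= tnth t i.
Hypotheses (mb1 : forall s, 0 <= s -> measurable_fun setT (b1 s))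
  (mb2 : forall s, 0 <= s -> measurable_fun setT (b2 s))
  (b10 : {ae P, forall w, b1 0 w = 0}) (b20 : {ae P, forall w, b2 0 w = 0})
  (cb1 : {ae P, forall w, forall (u : nat -> R) s, (forall n, 0 <= u n) ->
     u @ \oo --> s -> b1 (u n) w @[n --> \oo] --> b1 s w})
  (cb2 : {ae P, forall w, forall (u : nat -> R) s, (forall n, 0 <= u n) ->
     u @ \oo --> s -> b2 (u n) w @[n --> \oo] --> b2 s w}).
Hypothesis b12 : forall N (g : 'I_N -> R -> R) (delta : R), 0 <= delta ->
  (forall j, unit_continuous (g j)) ->
  (\int[P]_w (\prod_j g j (b1 (j.+1%:R * delta) w - b1 (j%:R * delta) w))%:E =
   \int[P]_w (\prod_j g j (b2 (j.+1%:R * delta) w - b2 (j%:R * delta) w))%:E)%E.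

(** Laws are identified by product test functions at two levels: for the grid increments the
    expectations agree by [b12], and for the drawdowns they are limits of expectations of functions
    of these increments. *)
Lemma drift_drawdown_same_law : exists Y1 Y2 : Omega -> n.-tuple (measurableTypeR R),
  [/\ measurable_fun setT Y1, measurable_fun setT Y2,
    {ae P, forall w, forall i, tnth (Y1 w) i = drift_drawdown x c alpha b1 w (tnth t i)},
    {ae P, forall w, forall i, tnth (Y2 w) i = drift_drawdown x c alpha b2 w (tnth t i)}
  & forall S, measurable S -> P (Y1 @^-1` S) = P (Y2 @^-1` S)].
Proof.
have [Y1 [mY1 Y1E Y1lim]] := drift_drawdown_version x c alpha n t t0 P b1 mb1 b10 cb1.
have [Y2 [mY2 Y2E Y2lim]] := drift_drawdown_version x c alpha n t t0 P b2 mb2 b20 cb2.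
exists Y1, Y2; split => //.
apply: tuple_law_unique => // g cg g01.
have hg i : unit_continuous (g i) by split.
have l1 := cvg_lim (@ereal_hausdorff R) (Y1lim g hg).
have l2 := cvg_lim (@ereal_hausdorff R) (Y2lim g hg).
apply: (etrans (esym (l1 _))); apply: etrans (l2 _); apply: congr_lim; apply/funext => k.
have mI1 := measurable_grid_increments n t b1 mb1 k.
have mI2 := measurable_grid_increments n t b2 mb2 k.
have law : forall S, measurable S ->
    P (grid_increments n t b1 k @^-1` S) = P (grid_increments n t b2 k @^-1` S).
  apply: tuple_law_unique => // g' cg' g01'.
  have hg' j : unit_continuous (g' j) by split.
  have k0 : (0 : R) <= k.+1%:R^-1 by rewrite invr_ge0.
  have e := b12 _ g' _ k0 hg'.
  etransitivity; last (etransitivity; [exact: e|]).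
    by apply: eq_integral => w _; congr EFin; apply: eq_bigr => j _; rewrite tnth_mktuple.
  by apply: eq_integral => w _; congr EFin; apply: eq_bigr => j _; rewrite tnth_mktuple.
apply: (integral_same_law _ _ P _ _ P _ _ (grid_increments n t b1 k) (grid_increments n t b2 k)
  (fun y => (\prod_i g i (tnth (grid_drawdown x c alpha n t k y) i))%:E)) => //.
  apply/measurable_EFinP; apply: measurable_prod => i _.
  apply: (measurableT_comp (f := g i) (g := fun y => tnth (grid_drawdown x c alpha n t k y) i)).
    exact: continuous_measurable_fun.
  by have /measurable_fun_tnthP := measurable_grid_drawdown x c alpha n t k; exact.
move=> y; rewrite lee_fin; apply: prodr_ge0 => i _.
by have /andP[] := g01 i (tnth (grid_drawdown x c alpha n t k y) i).
Qed.

End LawComparison.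

(** * Pathwise comparison of the time-changed drawdown with that of a drifted [dds] *)

Section PathComparison.
Context {R : realType} {d : measure_display} {Omega : measurableType d}.
Variables (P : probability Omega R) (F : R -> set (set Omega)) (W : R -> Omega -> R).
Hypotheses (hF : is_filtration F) (hW : brownian_motion F P W).
Variables (x c alpha : R) (X mu sigma T I : R -> Omega -> R).
Hypothesis halpha : 0 <= alpha <= 1.
Hypothesis cX : continuous_paths X.
Hypotheses (pmu : progressive F mu) (psigma : progressive F sigma).
Hypothesis fin : {ae P, forall w, forall t : R, 0 <= t ->
        (\int[lebesgue_measure]_(u in `[0%R, t])
           (`|mu u w| + sigma u w ^+ 2)%:E < +oo)%E}.
Hypothesis hI : is_ito_integral F P W sigma I.
Hypothesis XE : {ae P, forall w, forall t : R, 0 <= t ->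
          X t w = x + \int[lebesgue_measure]_(u in `[0, t]) mu u w + I t w}.
Hypothesis hT : inverse_time_change P (clock sigma) T.

Let msection (Z : R -> Omega -> R) t w : progressive F Z -> 0 <= t ->
  measurable_fun (`[0, t] : set (measurableTypeR R)) (fun u => Z u w : measurableTypeR R).
Proof. by move=> pZ t0; exact: (progressive_section F hF). Qed.

Lemma ae_sigma_fin : {ae P, forall w, forall t : R, 0 <= t ->
  (\int[lebesgue_measure]_(u in `[0%R, t]) (sigma u w ^+ 2)%:E < +oo)%E}.
Proof.
apply: filterS fin => w fw t t0; apply: le_lt_trans (fw t t0).
have m1 := msection mu t w pmu t0; have m2 := msection sigma t w psigma t0.
apply: ge0_le_integral => //.
- by move=> u _; rewrite lee_fin sqr_ge0.
- by apply/measurable_EFinP; exact: measurable_funX.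
- apply/measurable_EFinP; apply: measurable_funD; last exact: measurable_funX.
  exact: measurableT_comp.
- by move=> u _; rewrite lee_fin lerDr.
Qed.

Lemma ae_mu_integrable : {ae P, forall w, forall t : R, 0 <= t ->
  lebesgue_measure.-integrable `[0, t] (EFin \o (fun u => mu u w))}.
Proof.
apply: filterS fin => w fw t t0.
have m1 := msection mu t w pmu t0; have m2 := msection sigma t w psigma t0.
apply/integrableP; split; first exact/measurable_EFinP.
apply: le_lt_trans (fw t t0); apply: ge0_le_integral => //.
- by apply: measurableT_comp => //; exact/measurable_EFinP.
- apply/measurable_EFinP; apply: measurable_funD; last exact: measurable_funX.
  exact: measurableT_comp.
- by move=> u _; rewrite lee_fin lerDl sqr_ge0.
Qed.

(** The value at 0 is not part of the definition of the integral; it is inherited from the simple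
    integrals, which vanish there and converge uniformly. *)
Lemma ito_integral0 : {ae P, forall w, I 0 w = 0}.
Proof.
have [H [aH _ good]] := good_sequence P F W hF hW sigma I hI psigma.
apply: filterS good => w gw; apply/eqP; rewrite -normr_eq0 eq_le normr_ge0 andbT.
rewrite leNgt; apply/negP => I0.
have [k [[_ h1] h2]] := filter_ex (filterI gw (cvgr_lt _ dyadic_tol_cvg _ I0)).
have := h1 0; rewrite lexx ler0n => /(_ isT).
have -> : simple_integral W (H k) 0 w = 0.
  have [s0 s_mono _ _] := aH k.
  have snn q : 0 <= sp_time (H k) q by elim: q => [|q IH] //; exact: le_trans (s_mono q).
  by rewrite /simple_integral big1// => q _; rewrite !min_r ?snn// subrr mulr0.
by rewrite sub0r normrN leNgt h2.
Qed.

Lemma ae_dds0 : {ae P, forall w, dds I T 0 w = 0}.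
Proof.
apply: filterS2 (ae_clock_path P F hF sigma T psigma hT ae_sigma_fin) ito_integral0 => w [_ _ TA] I0.
by have := TA 0 (lexx 0); rewrite clock_path0 /dds => ->.
Qed.

Lemma ae_dds_cvg : {ae P, forall w, forall (u : nat -> R) s, (forall n, 0 <= u n) ->
     u @ \oo --> s -> dds I T (u n) w @[n --> \oo] --> dds I T s w}.
Proof.
apply: filterS (ae_clock_path P F hF sigma T psigma hT ae_sigma_fin) => w hw u s u0 us.
exact: (dds_path_cvg P F W sigma I T hI hT).
Qed.

Section FixedPath.
Variable w : Omega.
Hypotheses (hw : clock_path sigma T w)
  (intmu : forall t : R, 0 <= t -> lebesgue_measure.-integrable `[0, t] (EFin \o (fun u => mu u w)))
  (hX : forall t : R, 0 <= t -> X t w = x + \int[lebesgue_measure]_(u in `[0, t]) mu u w + I t w).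

Let intsigma t : 0 <= t -> lebesgue_measure.-integrable `[0, t] (EFin \o (fun u => sigma u w ^+ 2)).
Proof. by case: hw => h _ _; exact: h. Qed.

Let gap u := c * sigma u w ^+ 2 - mu u w.

Let intc t : 0 <= t -> lebesgue_measure.-integrable `[0, t] (EFin \o (fun u => c * sigma u w ^+ 2)).
Proof. by move=> t0; apply: (integrableZl _ c (intsigma t t0)). Qed.

(** The linear drift [c * t] is [c] times the clock at [T t], so it combines with the drift of [X]
    into one integral up to [T t]. *)
Lemma drift_gap t : 0 <= t -> X (T t w) w = drift_position x c (dds I T) w t -
  \int[lebesgue_measure]_(u in `[0, T t w]) gap u.
Proof.
move=> t0; have Tt0 : 0 <= T t w by exact: (time_ge0 P sigma T hT).
rewrite hX// /drift_position /dds /gap RintegralB//; [|exact: intc|exact: intmu].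
rewrite RintegralZl//; last exact: intsigma.
have := clock_pathK P sigma T hT w hw t t0; rewrite /clock => ->.
ring.
Qed.

Let Z := drift_position x c (dds I T) w.

Let cZ (u : nat -> R) s : (forall n, 0 <= u n) -> u @ \oo --> s -> Z (u n) @[n --> \oo] --> Z s.
Proof.
apply: drift_position_cvg => u' s' u0 us.
exact: (dds_path_cvg P F W sigma I T hI hT).
Qed.

Let cXw (u : nat -> R) s : (forall n, 0 <= u n) -> u @ \oo --> s -> X (u n) w @[n --> \oo] --> X s w.
Proof. exact: (within_cvgn _ (fun t => X t w)). Qed.

Let T0 t : 0 <= t -> 0 <= T t w. Proof. exact: (time_ge0 P sigma T hT). Qed.

Lemma drawdown_le t : (forall u, 0 <= u -> mu u w <= c * sigma u w ^+ 2) -> 0 <= t ->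
  time_changed_drawdown alpha X T t w <= drift_drawdown x c alpha (dds I T) w t.
Proof.
move=> mu_le t0; have gap0 u : 0 <= u -> 0 <= gap u by move=> u0; rewrite subr_ge0 mu_le.
have intgap s : 0 <= s -> lebesgue_measure.-integrable `[0, s] (EFin \o gap).
  move=> s0; have ms : measurable (`[0, s] : set (measurableTypeR R)) by exact: measurable_itv.
  exact: (integrableB ms (intc s s0) (intmu s s0)).
pose D s := \int[lebesgue_measure]_(u in `[0, T s w]) gap u.
have D0 : 0 <= D t.
  by apply: Rintegral_ge0 => u /=; rewrite in_itv/= => /andP[u0 _]; exact: gap0.
have [e /andP[e0 et] [_ supE]] := path_sup_attained Z cZ t t0.
have [r r0 [rmax rE]] := path_sup_attained (fun u => X u w) cXw (T t w) (T0 t t0).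
rewrite /time_changed_drawdown /running_max rE drift_gap// /drift_drawdown supE -/(D t) -/Z.
have Tet : T e w <= T t w by case: hw => _ h _; exact: h.
have h1 : X (T e w) w <= X r w by apply: rmax; rewrite T0.
have De : D e <= D t by apply: Rintegral_nonneg_mono => //; exact: T0.
have h2 : Z e - D e <= X r w by rewrite -drift_gap.
have /andP[a0 a1] := halpha.
(* Since [X r w >= Z e - D t], the left-hand side is at most
   [Z t - alpha * Z e - (1 - alpha) * D t]. *)
nra.
Qed.

Lemma drawdown_ge t : (forall u, 0 <= u -> mu u w = c * sigma u w ^+ 2) -> 0 <= t ->
  drift_drawdown x c alpha (dds I T) w t <= time_changed_drawdown alpha X T t w.
Proof.
move=> muE t0.
have XZ s : 0 <= s -> X (T s w) w = Z s.
  move=> s0; rewrite drift_gap// -/Z [X in _ - X](_ : _ = 0) ?subr0//.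
  transitivity (\int[lebesgue_measure]_(u in `[0, T s w]) (cst 0 u : R)).
    apply: eq_Rintegral => u; rewrite inE/= in_itv/= => /andP[u0 _].
    by rewrite /gap muE// subrr.
  by rewrite Rintegral_cst// mul0r.
have [e _ [emax supE]] := path_sup_attained Z cZ t t0.
have [r /andP[r0 rT] [rmax rE]] := path_sup_attained (fun u => X u w) cXw (T t w) (T0 t t0).
rewrite /time_changed_drawdown /running_max rE XZ// /drift_drawdown supE -/Z.
(* The maximiser [r] in [[0, T t]] is the image under [T] of its own clock value, which lies in
   [[0, t]]; so [X r w] is a value of [Z] on [[0, t]]. *)
have A0 : 0 <= clock sigma r w.
  by rewrite -(clock_path0 sigma w); exact: (clock_path_mono sigma T w hw).
have At : clock sigma r w <= t.
  rewrite -[leRHS](clock_pathK P sigma T hT w hw t t0).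
  exact: (clock_path_mono sigma T w hw).
have h1 : X r w <= Z e.
  have := XZ _ A0; rewrite (time_pathK sigma T w hw r r0) => ->.
  by apply: emax; rewrite A0.
have /andP[a0 a1] := halpha.
by rewrite lerD2l lerN2 ler_wpM2l.
Qed.

End FixedPath.

Lemma ae_drawdown_le :
  {ae P, forall w t, 0 <= t -> mu t w <= c * sigma t w ^+ 2} ->
  {ae P, forall w t, 0 <= t ->
     time_changed_drawdown alpha X T t w <= drift_drawdown x c alpha (dds I T) w t}.
Proof.
move=> hmu; apply: filterS2 (ae_clock_path P F hF sigma T psigma hT ae_sigma_fin)
  (filterI hmu (filterI ae_mu_integrable XE)) => w hw [h1 [h2 h3]] t.
exact: drawdown_le.
Qed.

Lemma ae_drawdown_ge :
  (forall w t, mu t w = c * sigma t w ^+ 2) ->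
  {ae P, forall w t, 0 <= t ->
     drift_drawdown x c alpha (dds I T) w t <= time_changed_drawdown alpha X T t w}.
Proof.
move=> hmu; apply: filterS3 (ae_clock_path P F hF sigma T psigma hT ae_sigma_fin)
  ae_mu_integrable XE => w hw h2 h3 t.
exact: drawdown_ge.
Qed.

End PathComparison.

(** [V1] and [V2] will be the time-changed drawdowns, controlled only through almost sure
    inequalities with the measurable versions [Y1] and [Y2]. Positive and negative parts are
    compared separately, each by passing through the common law. *)
Lemma expectation_monotone_law (R : realType) d (Omega : measurableType d) (P : probability Omega R)
    n (h : n.-tuple (measurableTypeR R) -> R) (V1 V2 Y1 Y2 : Omega -> n.-tuple (measurableTypeR R)) :
  measurable_fun setT h ->
  (forall a b, (forall i, tnth a i <= tnth b i) -> h a <= h b) ->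
  measurable_fun setT Y1 -> measurable_fun setT Y2 ->
  (forall S, measurable S -> P (Y1 @^-1` S) = P (Y2 @^-1` S)) ->
  {ae P, forall w, forall i, tnth (V1 w) i <= tnth (Y1 w) i} ->
  {ae P, forall w, forall i, tnth (Y2 w) i <= tnth (V2 w) i} ->
  ('E_P[h \o V1] <= 'E_P[h \o V2])%E.
Proof.
move=> mh h_mono mY1 mY2 law V1Y1 Y2V2.
have mhE : measurable_fun setT (EFin \o h) by exact/measurable_EFinP.
rewrite unlock [leLHS]integralE [leRHS]integralE; apply: leeB.
  apply: (@le_trans _ _ (\int[P]_w ((EFin \o h)^\+ (Y1 w)))%E).
    apply: ge0_le_integral_ae => //.
    apply: filterS V1Y1 => w /h_mono hw; rewrite !funeposE/=.
    by rewrite ge_max !le_max lee_fin hw lexx orbT.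
  rewrite (integral_same_law _ _ P _ _ P _ _ Y1 Y2)//; last exact: measurable_funepos.
  apply: ge0_le_integral_ae => //.
  apply: filterS Y2V2 => w /h_mono hw; rewrite !funeposE/=.
  by rewrite ge_max !le_max lee_fin hw lexx orbT.
apply: (@le_trans _ _ (\int[P]_w ((EFin \o h)^\- (Y2 w)))%E).
  apply: ge0_le_integral_ae => //.
  apply: filterS Y2V2 => w /h_mono hw; rewrite !funenegE/=.
  by rewrite ge_max !le_max lee_fin lerN2 hw lexx orbT.
rewrite -(integral_same_law _ _ P _ _ P _ _ Y1 Y2)//; last exact: measurable_funeneg.
apply: ge0_le_integral_ae => //.
apply: filterS V1Y1 => w /h_mono hw; rewrite !funenegE/=.
by rewrite ge_max !le_max lee_fin lerN2 hw lexx orbT.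
Qed.

Theorem theorem2p4 (R : realType) (d : measure_display)
    (Omega : measurableType d) (P : probability Omega R)
    (F : R -> set (set Omega)) (W : R -> Omega -> R)
    (hF : is_filtration F) (hW : brownian_motion F P W)
    (K : set (R * R)) (hK : forall p, K p -> 0 < p.2)
    (m s : R -> R)
    (hm : measurable_fun [set: measurableTypeR R] m)
    (hs : measurable_fun [set: measurableTypeR R] s)
    (s_gt0 : forall y, 0 < s y)
    (hms : forall y, (m y / s y ^+ 2)%:E =
       ereal_sup [set (p.1 / p.2 ^+ 2)%:E | p in K])
    (x : R) (x_ge0 : 0 <= x)
    (huniq : unique_weak_solution m s x)
    (Xstar : R -> Omega -> R)
    (hXstarA : admissible F P W (fun=> K) x Xstar)
    (hXstar : sde_solution F P W m s x Xstar)
    (X mu sigma : R -> Omega -> R)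
    (hX : admissible_with F P W (fun=> K) x X mu sigma)
    (T U : R -> Omega -> R)
    (hT : inverse_time_change P (clock sigma) T)
    (hU : inverse_time_change P (clock (fun t w => s (Xstar t w))) U)
    (alpha : R) (halpha : 0 <= alpha <= 1) :
  st_le P (time_changed_drawdown alpha X T)
        P (time_changed_drawdown alpha Xstar U).
Proof.
have c_const y : m y / s y ^+ 2 = m 0 / s 0 ^+ 2.
  by apply: EFin_inj; rewrite !hms.
pose c := m 0 / s 0 ^+ 2.
have [[[_ cX] pmu psigma finX [I hI XE]] XK] := hX.
have [[_ cXs] pm ps finXs [Is hIs XsE]] := hXstar.
have mu_le : {ae P, forall w t, 0 <= t -> mu t w <= c * sigma t w ^+ 2}.
  apply: filterS XK => w Kw t t0; have Kt := Kw t t0.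
  have sg0 : 0 < sigma t w := hK _ Kt.
  rewrite -ler_pdivrMr ?exprn_gt0// -lee_fin hms.
  by apply: ereal_sup_ubound; exists (mu t w, sigma t w).
have m_eq w t : m (Xstar t w) = c * s (Xstar t w) ^+ 2.
  by rewrite /c -(c_const (Xstar t w)) divfK// gt_eqF// exprn_gt0.
have finS := ae_sigma_fin P F hF mu sigma pmu psigma finX.
have finSs := ae_sigma_fin P F hF _ _ pm ps finXs.
move=> n t h st mh h_mono _ _.
have t0 i : 0 <= tnth t i.
  have /allP := order_path_min (@le_trans _ R) st; apply; exact: mem_tnth.
(* Both integrals are taken against the same [W], so the two expectations of products of increments
   equal the same product of heat terms. *)
have [Y1 [Y2 [mY1 mY2 Y1E Y2E law]]] := drift_drawdown_same_law P (dds I T) (dds Is U) x c alpha n t t0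
  (measurable_dds P F W sigma I T hI hT) (measurable_dds P F W _ Is U hIs hU)
  (ae_dds0 P F W hF hW mu sigma T I pmu psigma finX hI hT)
  (ae_dds0 P F W hF hW _ _ U Is pm ps finXs hIs hU)
  (ae_dds_cvg P F W hF mu sigma T I pmu psigma finX hI hT)
  (ae_dds_cvg P F W hF _ _ U Is pm ps finXs hIs hU)
  (fun N g delta d0 hg => etrans
    (expectation_dds_increments P F W hF hW sigma I T psigma hI hT finS N g delta d0 hg)
    (esym (expectation_dds_increments P F W hF hW _ Is U ps hIs hU finSs N g delta d0 hg))).
apply: (expectation_monotone_law _ _ _ P n h _ _ Y1 Y2) => //.
  apply: filterS2 Y1E (ae_drawdown_le P F W hF x c alpha X mu sigma T I halpha cX pmu psigma finX hI XE hT mu_le).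
  by move=> w Yw le i; rewrite tnth_mktuple Yw le.
apply: filterS2 Y2E (ae_drawdown_ge P F W hF x c alpha Xstar _ _ U Is halpha cXs pm ps finXs hIs XsE hU m_eq).
by move=> w Yw le i; rewrite tnth_mktuple Yw le.
Qed.
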